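(* Let $k\ge 1$ and $n_1,\dots,n_k\ge 1$ be integers. For $j=1,\dots,k$ let $B_j>O$ be a constant $n_j\times n_j$ Hermitian positive definite matrix. Let $\alpha_1,\dots,\alpha_{k+1},h\in\mathbb{C}$ satisfy $\Re(\alpha_j)>0$ for $j=1,\dots,k+1$, $\Re(\alpha_{k+1}-h)>0$, and $\Re\left(\sum_{j=1}^k(\alpha_j+n_j)+h\right)>0$. Let $E[\cdot]$ denote the average over the rectangular complex type-2 Dirichlet measure for $p=1$ with these parameters, on vectors $\tilde X_j\in\mathbb{C}^{n_j}$, and let $$\phi_9(\tilde X_1,\dots,\tilde X_k)=[\tilde X_1^{*}B_1\tilde X_1+\cdots+\tilde X_k^{*}B_k\tilde X_k]^{h}.$$ Then $$E[\phi_9]=\frac{\Gamma\left(\sum_{j=1}^k(\alpha_j+n_j)+h\right)}{\Gamma\left(\sum_{j=1}^k(\alpha_j+n_j)\right)}\,\frac{\Gamma(\alpha_{k+1}-h)}{\Gamma(\alpha_{k+1})}.$$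
   Context: $A>O$ means the Hermitian matrix $A$ is positive definite; $\tilde X^{*}$ is the conjugate transpose, so $\tilde X_j^{*}B_j\tilde X_j$ is a nonnegative real scalar for $\tilde X_j\in\mathbb{C}^{n_j}$. For a complex vector variable $\tilde X\in\mathbb{C}^n$, $d\tilde X$ is Lebesgue measure on $\mathbb{R}^{2n}$. The rectangular complex type-2 Dirichlet measure for $p=1$ has density $$f_4(\tilde X_1,\dots,\tilde X_k)=\tilde G_k\left(\prod_{j=1}^k[\tilde X_j^{*}B_j\tilde X_j]^{\alpha_j}\right)\left(1+\tilde X_1^{*}B_1\tilde X_1+\cdots+\tilde X_k^{*}B_k\tilde X_k\right)^{-(\alpha_1+\cdots+\alpha_{k+1}+n_1+\cdots+n_k)}$$ on the set of nonzero vectors $\tilde X_j\in\mathbb{C}^{n_j}$, $j=1,\dots,k$, where $$\tilde G_k=\left\{\prod_{j=1}^k\det(B_j)\,\frac{\Gamma(n_j)}{\pi^{n_j}\,\Gamma(\alpha_j+n_j)}\right\}\frac{\Gamma(\alpha_1+\cdots+\alpha_{k+1}+n_1+\cdots+n_k)}{\Gamma(\alpha_{k+1})}.$$ The Dirichlet average of $\phi$ is $E[\phi]=\int\phi\,f_4\,d\tilde X_1\cdots d\tilde X_k$. *)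

(* Defs.v *)
(* MathComp-Analysis: integrals are Lebesgue integrals over a [realType] [R], and
   complex numbers are [R[i]] from mathcomp-real-closed. *)
From HB Require Import structures.
From mathcomp Require Import all_boot all_order all_algebra complex.
From mathcomp Require Import all_classical all_reals all_analysis.

Set Implicit Arguments.
Unset Strict Implicit.
Unset Printing Implicit Defensive.

Import Order.TTheory GRing.Theory Num.Theory.
Import numFieldNormedType.Exports.

Local Open Scope classical_set_scope.
Local Open Scope ring_scope.
Local Open Scope complex_scope.
Local Open Scope sesquilinear_scope.

Section measure_power_step.
Context d (T : measurableType d) (R : realType) (n : nat).
Variables (m : {sigma_finite_measure set T -> \bar R})
  (mn : {sigma_finite_measure set (n.-tuple T) -> \bar R}).

Definition tcons (z : T * n.-tuple T) : n.+1.-tuple T :=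
  [the n.+1.-tuple T of z.1 :: z.2].

Lemma measurable_tcons : measurable_fun [set: T * n.-tuple T] tcons.
Proof. exact: measurable_cons. Qed.

Definition power_step : set (n.+1.-tuple T) -> \bar R :=
  pushforward (m \x mn)%E tcons.

Let power_step0 : power_step set0 = 0%E.
Proof. by rewrite /power_step /pushforward preimage_set0 measure0. Qed.

Let power_step_ge0 A : (0 <= power_step A)%E.
Proof. by rewrite /power_step /pushforward measure_ge0. Qed.

Let power_step_sigma_additive : semi_sigma_additive power_step.
Proof.
move=> F mF tF mUF; rewrite /power_step /pushforward preimage_bigcup.
have mtc := measurable_tcons.
apply: measure_semi_sigma_additive.
- by move=> i; rewrite -[X in measurable X]setTI; exact: mtc.
- apply/trivIsetP => /= i j _ _ ij; rewrite -preimage_setI.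
  by move/trivIsetP : tF => /(_ _ _ _ _ ij) ->//; rewrite preimage_set0.
- by rewrite -preimage_bigcup -[X in measurable X]setTI; exact: mtc.
Qed.

HB.instance Definition _ := isMeasure.Build _ _ _ power_step
  power_step0 power_step_ge0 power_step_sigma_additive.

Lemma power_stepE (A : set T) (B : set (n.-tuple T)) :
  measurable A -> measurable B ->
  power_step [set t | A (thead t) /\ B [tuple of behead t]] = (m A * mn B)%E.
Proof.
move=> mA mB; rewrite -product_measure1E// /power_step /pushforward.
congr ((m \x mn)%E _); apply/seteqP; split=> -[x t] /=;
  by rewrite theadE (_ : [tuple of behead (x :: t)] = t)//; exact: val_inj.
Qed.

Let measurable_box (A : set T) (B : set (n.-tuple T)) :
  measurable A -> measurable B ->
  measurable [set t : n.+1.-tuple T | A (thead t) /\ B [tuple of behead t]].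
Proof.
move=> mA mB; apply: measurableI.
- have := @measurable_tnth _ T n.+1 ord0 measurableT _ mA.
  by rewrite setTI.
- have := @measurable_behead _ T n measurableT _ mB.
  by rewrite setTI.
Qed.

Let power_step_sigma_finite : sigma_finite setT power_step.
Proof.
have /sigma_finiteP[F [TF ndF Foo]] := sigma_finiteT m.
have /sigma_finiteP[G [TG ndG Goo]] := sigma_finiteT mn.
exists (fun i => [set t | F i (thead t) /\ G i [tuple of behead t]]).
  apply/seteqP; split=> // t _.
  have : (\bigcup_i F i) (thead t) by rewrite -TF.
  have : (\bigcup_i G i) [tuple of behead t] by rewrite -TG.
  move=> [j _ Gj] [i _ Fi]; exists (maxn i j) => //; split.
  - by move: Fi; exact/subsetPset/ndF/leq_maxl.
  - by move: Gj; exact/subsetPset/ndG/leq_maxr.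
move=> i; have [? ?] := Foo i; have [? ?] := Goo i.
split; first exact: measurable_box.
by rewrite power_stepE// lte_mul_pinfty// ge0_fin_numE.
Qed.

HB.instance Definition _ := Measure_isSigmaFinite.Build _ _ _ power_step
  power_step_sigma_finite.

End measure_power_step.

Fixpoint measure_power d (T : measurableType d) (R : realType)
    (m : {sigma_finite_measure set T -> \bar R}) (n : nat) :
    {sigma_finite_measure set (n.-tuple T) -> \bar R} :=
  if n is n'.+1 then [the {sigma_finite_measure set (n'.+1.-tuple T) -> \bar R}
    of power_step m (measure_power m n')]
  else [the {sigma_finite_measure set (0.-tuple T) -> \bar R} of \d_ [tuple]].

Lemma measure_power_box d (T : measurableType d) (R : realType)
    (m : {sigma_finite_measure set T -> \bar R}) (n : nat) (A : 'I_n -> set T) :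
  (forall i, measurable (A i)) ->
  measure_power m n [set t | forall i, A i (tnth t i)] =
  (\prod_(i < n) m (A i))%E.
Proof.
elim: n A => [|n IHn] A mA.
  rewrite big_ord0 /= diracE mem_set//; by case.
rewrite big_ord_recl -IHn//= -power_stepE//; last first.
  rewrite [X in measurable X](_ : _ = \bigcap_(i in [set: 'I_n])
      ((fun t : n.-tuple T => tnth t i) @^-1` A (lift ord0 i))); last first.
    by apply/seteqP; split=> t /= At i => [_|]; [exact: At|exact: (At i I)].
  apply: fin_bigcap_measurable => // i _.
  have := @measurable_tnth _ T n i measurableT _ (mA (lift ord0 i)).
  by rewrite setTI.
congr (power_step m _ _); apply/seteqP; split=> t /=.
  move=> At; split=> [|i]; first exact: At ord0.
  by have := At (lift ord0 i); rewrite [in X in X -> _](tuple_eta t) tnthS.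
move=> [At0 At] i; have [->//|] := eqVneq i ord0.
rewrite eq_sym => /unlift_some[j -> _].
by rewrite [t in tnth t](tuple_eta t) tnthS; exact: At.
Qed.

Section lebesgue_plane.
Context {R : realType}.

(* Borel sigma-algebra on R * R, with (x, y) standing for x + i y. *)
Definition planeC := (measurableTypeR R * measurableTypeR R)%type.

Definition lebesgue_plane : set planeC -> \bar R :=
  (@lebesgue_measure R \x @lebesgue_measure R)%E.

HB.instance Definition _ := Measure.on lebesgue_plane.

Let lebesgue_plane_sigma_finite : sigma_finite setT lebesgue_plane.
Proof.
have /sigma_finiteP[F [TF ndF Foo]] := sigma_finiteT (@lebesgue_measure R).
exists (fun i => F i `*` F i).
  apply/seteqP; split=> // -[x y] _.
  have : (\bigcup_i F i) x by rewrite -TF.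
  have : (\bigcup_i F i) y by rewrite -TF.
  move=> [j _ Fj] [i _ Fi]; exists (maxn i j) => //; split.
  - by move: Fi; exact/subsetPset/ndF/leq_maxl.
  - by move: Fj; exact/subsetPset/ndF/leq_maxr.
move=> i; have [? ?] := Foo i; split; first exact: measurableX.
by rewrite /lebesgue_plane product_measure1E// lte_mul_pinfty// ge0_fin_numE.
Qed.

HB.instance Definition _ := Measure_isSigmaFinite.Build _ _ _
  lebesgue_plane lebesgue_plane_sigma_finite.

End lebesgue_plane.
Arguments planeC : clear implicits.

Section complex_analysis.
Context {R : realType}.
Implicit Types (x t : R) (z a : R[i]).

(* x ^ a = exp (a ln x), for a base x > 0. *)
Definition cpow x a : R[i] :=
  (expR (complex.Re a * ln x))%:C *
  (cos (complex.Im a * ln x) +i* sin (complex.Im a * ln x)).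

Definition cintegrable d (T : measurableType d)
    (mu : {measure set T -> \bar R}) (D : set T) (f : T -> R[i]) : Prop :=
  mu.-integrable D (EFin \o (fun w => complex.Re (f w))) /\
  mu.-integrable D (EFin \o (fun w => complex.Im (f w))).

(* Meaningful when [cintegrable mu D f]. *)
Definition cintegral d (T : measurableType d)
    (mu : {measure set T -> \bar R}) (D : set T) (f : T -> R[i]) : R[i] :=
  (\int[mu]_(w in D) complex.Re (f w)) +i* (\int[mu]_(w in D) complex.Im (f w)).

(* Euler's integral, which converges exactly for Re z > 0. *)
Definition cGamma z : R[i] :=
  cintegral (@lebesgue_measure R) `]0, +oo[%classic
    (fun t => cpow t (z - 1) * (expR (- t))%:C).

End complex_analysis.

Section rectangular_dirichlet.
Context {R : realType}.

Definition posdefmx n (B : 'M[R[i]]_n) : Prop :=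
  B \is hermsymmx /\
  forall X : 'cV[R[i]]_n, X != 0 -> 0 < (X ^t* *m B *m X) 0 0.

(* X^* B X is a real number when B is Hermitian; [complex.Re] only changes its
   type. *)
Definition qform n (B : 'M[R[i]]_n) (X : 'cV[R[i]]_n) : R :=
  complex.Re ((X ^t* *m B *m X) 0 0).

(* Lebesgue measure on C^N = R^(2N). *)
Definition lebesgueC (N : nat) :
    {sigma_finite_measure set (N.-tuple (planeC R)) -> \bar R} :=
  measure_power (@lebesgue_plane R) N.

Definition col_of_tuple N (x : N.-tuple (planeC R)) : 'cV[R[i]]_N :=
  \col_i (((tnth x i).1 : R) +i* ((tnth x i).2 : R)).

Context {k : nat} {n : 'I_k -> nat}.

Definition blocks : Type := forall j : 'I_k, 'cV[R[i]]_(n j).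

(* C^(n_1 + .. + n_k) = C^(n_1) x .. x C^(n_k) *)
Definition blocks_of_tuple (x : (\sum_j n j).-tuple (planeC R)) : blocks :=
  fun j => submxcol (col_of_tuple x) j.

Definition nonzero_blocks : set ((\sum_j n j).-tuple (planeC R)) :=
  [set x | forall j, blocks_of_tuple x j != 0].

Variables (B : forall j, 'M[R[i]]_(n j)) (alpha : 'I_k.+1 -> R[i]).

(* alpha_1, .., alpha_k are [alpha (inI j)]; alpha_(k+1) is [alpha ord_max]. *)
Definition inI (j : 'I_k) : 'I_k.+1 := widen_ord (leqnSn k) j.

Definition dirichlet2_exponent : R[i] :=
  \sum_(j < k.+1) alpha j + \sum_(j < k) (n j)%:R.

Definition dirichlet2_const : R[i] :=
  (\prod_(j < k) (\det (B j) * (cGamma (n j)%:R /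
     ((pi ^+ n j)%:C * cGamma (alpha (inI j) + (n j)%:R))))) *
  (cGamma dirichlet2_exponent / cGamma (alpha ord_max)).

Definition dirichlet2_density (X : blocks) : R[i] :=
  dirichlet2_const *
  (\prod_(j < k) cpow (qform (B j) (X j)) (alpha (inI j))) *
  cpow (1 + \sum_(j < k) qform (B j) (X j)) (- dirichlet2_exponent).

Definition dirichlet2_integrable (phi : blocks -> R[i]) : Prop :=
  cintegrable (lebesgueC (\sum_j n j)) nonzero_blocks
    (fun x => phi (blocks_of_tuple x) * dirichlet2_density (blocks_of_tuple x)).

Definition dirichlet2_average (phi : blocks -> R[i]) : R[i] :=
  cintegral (lebesgueC (\sum_j n j)) nonzero_blocks
    (fun x => phi (blocks_of_tuple x) * dirichlet2_density (blocks_of_tuple x)).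

Definition phi9 (h : R[i]) (X : blocks) : R[i] :=
  cpow (\sum_(j < k) qform (B j) (X j)) h.

End rectangular_dirichlet.

(* Main.v *)
Require Import Defs.
From mathcomp Require Import all_boot all_order all_algebra complex.
From mathcomp Require Import all_classical all_reals all_analysis.
From mathcomp Require Import measurable_realfun.
From mathcomp Require Import ring lra.

(* Let q be the sum of the quadratic forms Q_j, N = n_1 + .. + n_k,
   a = alpha_1 + .. + alpha_k and S = a + N. The integrand is a constant times
   F(x) G(q(x)), where F = prod_j Q_j^alpha_j q^(-a) is invariant under dilations
   and G(u) = u^(a + h) (1 + u)^(- S - alpha_(k+1)). Polar decomposition gives
     Gamma(N) int F G(q) = int F e^(-q) * int_0^oo u^(N - 1) G(u) du,
   and comparing with G(u) = u^a e^(-u) eliminates the angular factor int F e^(-q):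
     Gamma(S) int F G(q) = int prod_j Q_j^alpha_j e^(-Q_j) * int_0^oo u^(N - 1) G(u) du.
   The first integral on the right is computed one block at a time by the same
   polar decomposition, starting from the Gaussian integral pi^N / prod_j det B_j
   (Schur complements); the second one is the Beta integral
   Gamma(S + h) Gamma(alpha_(k+1) - h) / Gamma(S + alpha_(k+1)). Solving for
   int F G(q) needs that Gamma does not vanish on the right half-plane. *)

Import Order.TTheory GRing.Theory Num.Theory.
Import numFieldNormedType.Exports.

Set Implicit Arguments.
Unset Strict Implicit.
Unset Printing Implicit Defensive.

Local Open Scope classical_set_scope.
Local Open Scope ring_scope.
Local Open Scope complex_scope.
Local Open Scope sesquilinear_scope.

(** Two obstacles shape the argument. The parameters are complex, while Tonelli and the
    substitutions hold without integrability conditions only for nonnegative integrands; each change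
    of variables is therefore cast as a factorisation of one integral into two, a form that extends
    to complex integrands. And integrability has to be proved along with every value. For the Beta
    integrand and for F e^(-q) no estimate is made: the nonnegative formula, valid in [0, +oo], is
    read with real exponents, where a finite product with a strictly positive cofactor forces the
    other factor to be finite.

    No substitution beyond one-dimensional affine ones occurs, hence no Jacobian matrix and no
    measure on spheres. The price is an angular integral of unknown value, which is why two radial
    functions have to be compared. Dilations act on a chosen set of blocks: on a single block they
    switch the exponent of one Q_j from 0 to alpha_j in the Gaussian, on all blocks they separate q
    from the angular factor. *)

Section fubini_set.
Local Open Scope ereal_scope.
Context d1 d2 (T1 : measurableType d1) (T2 : measurableType d2) (R : realType).
Variables (m1 : {sigma_finite_measure set T1 -> \bar R})
  (m2 : {sigma_finite_measure set T2 -> \bar R}).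
Variables (D1 : set T1) (D2 : set T2) (mD1 : measurable D1) (mD2 : measurable D2).
Variable f : T1 * T2 -> \bar R.
Hypothesis mf : measurable_fun (D1 `*` D2) f.
Hypothesis f0 : forall x y, D1 x -> D2 y -> 0 <= f (x, y).

(** Extension by zero makes measurability and nonnegativity global, so that Tonelli on the whole
    product yields the statements on a rectangle. *)
Let g := f \_ (D1 `*` D2).

Let mg : measurable_fun setT g.
Proof. exact: (measurable_restrictT _ (measurableX mD1 mD2)).1. Qed.

Let g0 z : 0 <= g z.
Proof.
rewrite /g patchE; case: ifPn => //; case: z => x y /set_mem[/=].
exact: f0.
Qed.

Let g1 : \int[m1]_(x in D1) \int[m2]_(y in D2) f (x, y) =
  \int[m1]_x \int[m2]_y g (x, y).
Proof.
rewrite integral_mkcond; apply: eq_integral => x _; rewrite patchE.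
case: ifPn => [/set_mem D1x|/negP D1x].
  rewrite integral_mkcond; apply: eq_integral => y _; rewrite /g !patchE.
  by rewrite in_setX/= [x \in D1]mem_set.
rewrite integral0_eq// => y _; rewrite /g patchE in_setX/=.
by case: ifPn => // /andP[].
Qed.

Let g2 : \int[m2]_(y in D2) \int[m1]_(x in D1) f (x, y) =
  \int[m2]_y \int[m1]_x g (x, y).
Proof.
rewrite integral_mkcond; apply: eq_integral => y _; rewrite patchE.
case: ifPn => [/set_mem D2y|/negP D2y].
  rewrite integral_mkcond; apply: eq_integral => x _; rewrite /g !patchE.
  by rewrite in_setX/= [y \in D2]mem_set// andbT.
rewrite integral0_eq// => x _; rewrite /g patchE in_setX/=.
by case: ifPn => // /andP[].
Qed.

Lemma fubini_tonelli_set :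
  \int[m1]_(x in D1) \int[m2]_(y in D2) f (x, y) =
  \int[m2]_(y in D2) \int[m1]_(x in D1) f (x, y).
Proof. by rewrite g1 g2; exact: fubini_tonelli. Qed.

Lemma fubini_tonelli_set1 :
  \int[m1 \x m2]_(z in D1 `*` D2) f z =
  \int[m1]_(x in D1) \int[m2]_(y in D2) f (x, y).
Proof. by rewrite g1 -fubini_tonelli1// [LHS]integral_mkcond. Qed.

Lemma fubini_tonelli_set2 :
  \int[m1 \x m2]_(z in D1 `*` D2) f z =
  \int[m2]_(y in D2) \int[m1]_(x in D1) f (x, y).
Proof. by rewrite g2 -fubini_tonelli2// [LHS]integral_mkcond. Qed.

End fubini_set.

(** * Product formulas: from nonnegative to real and complex integrands *)

Section bilinear_real.
Local Open Scope ereal_scope.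
Context dT dU dV dX dY (T : measurableType dT) (U : measurableType dU)
  (V : measurableType dV) (X : measurableType dX) (Y : measurableType dY)
  (R : realType).
Variables (mu : {measure set T -> \bar R}) (mu1 : {measure set U -> \bar R})
  (mu2 : {measure set V -> \bar R}) (D : set T) (D1 : set U) (D2 : set V)
  (w : T -> R) (w1 : U -> R) (w2 : V -> R)
  (p : T -> X) (p1 : U -> X) (q : T -> Y) (q2 : V -> Y).
Hypotheses (mD : measurable D) (mD1 : measurable D1) (mD2 : measurable D2).
Hypotheses (mw : measurable_fun setT w) (mw1 : measurable_fun setT w1)
  (mw2 : measurable_fun setT w2).
Hypotheses (mp : measurable_fun setT p) (mp1 : measurable_fun setT p1)
  (mq : measurable_fun setT q) (mq2 : measurable_fun setT q2).
Hypotheses (w0 : forall x, D x -> (0 <= w x)%R)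
  (w10 : forall x, D1 x -> (0 <= w1 x)%R) (w20 : forall x, D2 x -> (0 <= w2 x)%R).

(* The changes of variables below are proved for nonnegative integrands in this
   form; bilinearity in (f, g) then carries them over to complex ones. *)
Definition product_formula := forall (f : X -> R) (g : Y -> R),
  measurable_fun setT f -> measurable_fun setT g ->
  (forall x, 0 <= f x)%R -> (forall y, 0 <= g y)%R ->
  \int[mu]_(x in D) (w x * (f (p x) * g (q x)))%:E =
  \int[mu1]_(u in D1) (w1 u * f (p1 u))%:E *
  \int[mu2]_(v in D2) (w2 v * g (q2 v))%:E.

Hypothesis H : product_formula.

Section real.
Variables (f : X -> R) (g : Y -> R).
Hypotheses (mf : measurable_fun setT f) (mg : measurable_fun setT g).
Hypotheses (if1 : mu1.-integrable D1 (fun u => (w1 u * f (p1 u))%:E))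
  (ig2 : mu2.-integrable D2 (fun v => (w2 v * g (q2 v))%:E)).

Let mwfg : measurable_fun D (fun x => (w x * (f (p x) * g (q x)))%:E).
Proof.
apply/measurable_EFinP/measurable_funTS.
by apply: measurable_funM => //; apply: measurable_funM; exact: measurableT_comp.
Qed.

Lemma product_formula_integrable :
  mu.-integrable D (fun x => (w x * (f (p x) * g (q x)))%:E).
Proof.
apply/integrableP; split => //.
move/integrableP : if1 => [_ fi]; move/integrableP : ig2 => [_ gi].
under eq_integral => x /set_mem Dx.
  rewrite abse_EFin !normrM (ger0_norm (w0 Dx)); over.
(* Applied to absolute values, the formula itself gives the bound: a product of two finite
   integrals. *)
rewrite (H (f := fun x => `|f x|%R) (g := fun x => `|g x|%R))//; last 2 first.
- exact: measurableT_comp.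
- exact: measurableT_comp.
rewrite lte_mul_pinfty//.
- by apply: integral_ge0 => x Dx; rewrite lee_fin mulr_ge0// w10.
- rewrite ge0_fin_numE; last first.
    by apply: integral_ge0 => x Dx; rewrite lee_fin mulr_ge0// w10.
  move: fi; under eq_integral => x /set_mem Dx.
    rewrite abse_EFin !normrM (ger0_norm (w10 Dx)); over.
  by [].
- move: gi; under eq_integral => x /set_mem Dx.
    rewrite abse_EFin !normrM (ger0_norm (w20 Dx)); over.
  by [].
Qed.

End real.

Lemma product_formula_Rintegral (f : X -> R) (g : Y -> R) :
  measurable_fun setT f -> measurable_fun setT g ->
  mu1.-integrable D1 (fun u => (w1 u * f (p1 u))%:E) ->
  mu2.-integrable D2 (fun v => (w2 v * g (q2 v))%:E) ->
  (\int[mu]_(x in D) (w x * (f (p x) * g (q x))) =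
   \int[mu1]_(u in D1) (w1 u * f (p1 u)) * \int[mu2]_(v in D2) (w2 v * g (q2 v)))%R.
Proof.
move=> mf mg if1 ig2.
have nneg (h : X -> R) (k : Y -> R) :
    measurable_fun setT h -> measurable_fun setT k ->
    (forall x, 0 <= h x)%R -> (forall x, 0 <= k x)%R ->
    mu1.-integrable D1 (fun u => (w1 u * h (p1 u))%:E) ->
    mu2.-integrable D2 (fun v => (w2 v * k (q2 v))%:E) ->
  (\int[mu]_(x in D) (w x * (h (p x) * k (q x))) =
   \int[mu1]_(u in D1) (w1 u * h (p1 u)) * \int[mu2]_(v in D2) (w2 v * k (q2 v)))%R.
  by move=> mh mk h0 k0 ih ik; rewrite /Rintegral H// fineM//;
    exact: integrable_fin_num.
pose pos d (A : measurableType d) (h : A -> R) a := Num.max (h a) 0%R.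
have mpos d (A : measurableType d) (h : A -> R) :
    measurable_fun setT h -> measurable_fun setT (pos d A h).
  by move=> mh; apply: measurable_maxr.
have pos0 d (A : measurableType d) (h : A -> R) a : (0 <= pos d A h a)%R.
  by rewrite /pos le_max lexx orbT.
have posB d (A : measurableType d) (h : A -> R) a :
    (pos d A h a - pos d A (\- h) a)%R = h a.
  rewrite /pos /=; have [h0|h0] := ltP 0%R (h a).
    by rewrite max_r ?subr0// oppr_le0; exact: ltW.
  by rewrite max_l ?sub0r ?opprK// oppr_ge0.
have pos_le d (A : measurableType d) (h : A -> R) a :
    (`|pos d A h a| <= `|h a|)%R.
  rewrite ger0_norm// /pos; have [h0|h0] := ltP 0%R (h a) => //.
  exact: ler_norm.
have ipos d (A : measurableType d) dB (B : measurableType dB)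
    (m : {measure set A -> \bar R}) (E : set A) (v : A -> R) (s : A -> B)
    (h h' : B -> R) :
    measurable E -> measurable_fun setT v -> measurable_fun setT s ->
    measurable_fun setT h' -> (forall b, `|h' b| <= `|h b|)%R ->
    m.-integrable E (fun a => (v a * h (s a))%:E) ->
    m.-integrable E (fun a => (v a * h' (s a))%:E).
  move=> mE mv ms mh hh ih; apply: le_integrable ih => //.
    apply/measurable_EFinP/measurable_funTS; apply: measurable_funM => //.
    exact: measurableT_comp.
  by move=> a Ea; rewrite !abse_EFin lee_fin !normrM ler_wpM2l.
(* Signs are removed one factor at a time: here the first factor is split into positive and negative
   parts while the second stays nonnegative. The end of the proof splits [g] and applies this to
   each of its parts. *)
have half (h : X -> R) (k : Y -> R) :
    measurable_fun setT h -> measurable_fun setT k -> (forall x, 0 <= k x)%R ->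
    mu1.-integrable D1 (fun u => (w1 u * h (p1 u))%:E) ->
    mu2.-integrable D2 (fun v => (w2 v * k (q2 v))%:E) ->
  (\int[mu]_(x in D) (w x * (h (p x) * k (q x))) =
   \int[mu1]_(u in D1) (w1 u * h (p1 u)) * \int[mu2]_(v in D2) (w2 v * k (q2 v)))%R.
  move=> mh mk k0 ih ik.
  have mnh : measurable_fun setT (\- h)%R by exact: measurableT_comp.
  have i1 := ipos _ _ _ _ _ _ _ _ _ _ mD1 mw1 mp1 (mpos _ _ _ mh) (pos_le _ _ h) ih.
  have i2 : mu1.-integrable D1 (fun u => (w1 u * pos _ _ (\- h)%R (p1 u))%:E).
    apply: ipos ih => //; first exact: mpos.
    by move=> a; rewrite (le_trans (pos_le _ _ _ _))//= normrN.
  under eq_Rintegral do rewrite -(posB _ _ h) mulrBl mulrBr.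
  under [in RHS]eq_Rintegral do rewrite -(posB _ _ h) mulrBr.
  rewrite RintegralB//; last 2 first.
  - by apply: (product_formula_integrable (f := pos _ _ h)) => //; exact: mpos.
  - by apply: (product_formula_integrable (f := pos _ _ (\- h)%R)) => //; exact: mpos.
  rewrite [X in _ = (X * _)%R]RintegralB// mulrBl nneg// ?nneg//; exact: mpos.
have mng : measurable_fun setT (\- g)%R by exact: measurableT_comp.
have i1 := ipos _ _ _ _ _ _ _ _ _ _ mD2 mw2 mq2 (mpos _ _ _ mg) (pos_le _ _ g) ig2.
have i2 : mu2.-integrable D2 (fun u => (w2 u * pos _ _ (\- g)%R (q2 u))%:E).
  apply: ipos ig2 => //; first exact: mpos.
  by move=> a; rewrite (le_trans (pos_le _ _ _ _))//= normrN.
under eq_Rintegral do rewrite -(posB _ _ g) !mulrBr.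
under [X in _ = (_ * X)%R]eq_Rintegral do rewrite -(posB _ _ g) mulrBr.
rewrite RintegralB//; last 2 first.
- by apply: (product_formula_integrable (g := pos _ _ g)) => //; exact: mpos.
- by apply: (product_formula_integrable (g := pos _ _ (\- g)%R)) => //; exact: mpos.
by rewrite [X in _ = (_ * X)%R]RintegralB// mulrBr half// ?half//; exact: mpos.
Qed.

End bilinear_real.

Section complex_integral.
Context {R : realType}.
Implicit Types (r : R) (z : R[i]).

Lemma complex_ReM z1 z2 : complex.Re (z1 * z2) =
  complex.Re z1 * complex.Re z2 - complex.Im z1 * complex.Im z2.
Proof. by case: z1; case: z2. Qed.

Lemma complex_ImM z1 z2 : complex.Im (z1 * z2) =
  complex.Re z1 * complex.Im z2 + complex.Im z1 * complex.Re z2.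
Proof. by case: z1; case: z2. Qed.

Lemma complex_ReZ r z : complex.Re (r%:C * z) = r * complex.Re z.
Proof. by rewrite complex_ReM /= mul0r subr0. Qed.

Lemma complex_ImZ r z : complex.Im (r%:C * z) = r * complex.Im z.
Proof. by rewrite complex_ImM /= mul0r addr0. Qed.

Definition cmeasurable d (T : measurableType d) (f : T -> R[i]) : Prop :=
  measurable_fun setT (fun x => complex.Re (f x)) /\
  measurable_fun setT (fun x => complex.Im (f x)).

Lemma cmeasurableM d (T : measurableType d) (f g : T -> R[i]) :
  cmeasurable f -> cmeasurable g -> cmeasurable (fun x => f x * g x).
Proof.
move=> [f1 f2] [g1 g2]; split.
  under eq_fun do rewrite complex_ReM.
  by apply: measurable_funB; exact: measurable_funM.
under eq_fun do rewrite complex_ImM.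
by apply: measurable_funD; exact: measurable_funM.
Qed.

Lemma cmeasurable_comp d1 d2 (T1 : measurableType d1) (T2 : measurableType d2)
    (f : T2 -> R[i]) (g : T1 -> T2) :
  cmeasurable f -> measurable_fun setT g -> cmeasurable (f \o g).
Proof. by move=> [f1 f2] mg; split; [exact: (measurableT_comp f1)|exact: (measurableT_comp f2)]. Qed.

Lemma cmeasurable_real d (T : measurableType d) (f : T -> R) :
  measurable_fun setT f -> cmeasurable (fun x => (f x)%:C).
Proof. by move=> mf; split => //=; exact: measurable_cst. Qed.

Lemma eq_cintegral d (T : measurableType d) (mu : {measure set T -> \bar R})
    (D : set T) (f g : T -> R[i]) :
  {in D, f =1 g} -> cintegral mu D f = cintegral mu D g.
Proof.
move=> fg; rewrite /cintegral.
by congr (_ +i* _); apply: eq_Rintegral => x Dx; rewrite fg.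
Qed.

Lemma eq_cintegrable d (T : measurableType d) (mu : {measure set T -> \bar R})
    (D : set T) (f g : T -> R[i]) : measurable D ->
  {in D, f =1 g} -> cintegrable mu D f -> cintegrable mu D g.
Proof.
move=> mD fg [i1 i2]; split.
  by apply: eq_integrable i1 => // x Dx /=; rewrite fg.
by apply: eq_integrable i2 => // x Dx /=; rewrite fg.
Qed.

Lemma cintegrableZ d (T : measurableType d) (mu : {measure set T -> \bar R})
    (D : set T) (f : T -> R[i]) z : measurable D ->
  cintegrable mu D f -> cintegrable mu D (fun x => z * f x).
Proof.
move=> mD [i1 i2]; split.
  have := integrableB mD (integrableZl mD (complex.Re z) i1)
                         (integrableZl mD (complex.Im z) i2).
  by apply: eq_integrable => // x Dx /=; rewrite complex_ReM.
have := integrableD mD (integrableZl mD (complex.Re z) i2)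
                       (integrableZl mD (complex.Im z) i1).
by apply: eq_integrable => // x Dx /=; rewrite complex_ImM.
Qed.

Lemma cintegralZ d (T : measurableType d) (mu : {measure set T -> \bar R})
    (D : set T) (f : T -> R[i]) z : measurable D ->
  cintegrable mu D f -> cintegral mu D (fun x => z * f x) = z * cintegral mu D f.
Proof.
move=> mD [i1 i2]; rewrite /cintegral; case: z => a b; simpc; congr (_ +i* _).
  under eq_Rintegral do rewrite complex_ReM /=.
  rewrite RintegralB ?RintegralZl//.
    exact: (integrableZl mD a i1).
  exact: (integrableZl mD b i2).
under eq_Rintegral do rewrite complex_ImM /=.
rewrite RintegralD ?RintegralZl//.
  exact: (integrableZl mD a i2).
exact: (integrableZl mD b i1).
Qed.

End complex_integral.

Section bilinear_complex.
Context dT dU dV dX dY (T : measurableType dT) (U : measurableType dU)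
  (V : measurableType dV) (X : measurableType dX) (Y : measurableType dY)
  (R : realType).
Variables (mu : {measure set T -> \bar R}) (mu1 : {measure set U -> \bar R})
  (mu2 : {measure set V -> \bar R}) (D : set T) (D1 : set U) (D2 : set V)
  (w : T -> R) (w1 : U -> R) (w2 : V -> R)
  (p : T -> X) (p1 : U -> X) (q : T -> Y) (q2 : V -> Y).
Hypotheses (mD : measurable D) (mD1 : measurable D1) (mD2 : measurable D2).
Hypotheses (mw : measurable_fun setT w) (mw1 : measurable_fun setT w1)
  (mw2 : measurable_fun setT w2).
Hypotheses (mp : measurable_fun setT p) (mp1 : measurable_fun setT p1)
  (mq : measurable_fun setT q) (mq2 : measurable_fun setT q2).
Hypotheses (w0 : forall x, D x -> (0 <= w x)%R)
  (w10 : forall x, D1 x -> (0 <= w1 x)%R) (w20 : forall x, D2 x -> (0 <= w2 x)%R).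
Hypothesis H : product_formula mu mu1 mu2 D D1 D2 w w1 w2 p p1 q q2.
Variables (f : X -> R[i]) (g : Y -> R[i]).
Hypotheses (mf : cmeasurable f) (mg : cmeasurable g).
Hypotheses (if1 : cintegrable mu1 D1 (fun u => (w1 u)%:C * f (p1 u)))
  (ig2 : cintegrable mu2 D2 (fun v => (w2 v)%:C * g (q2 v))).

Let if1' : mu1.-integrable D1 (fun u => (w1 u * complex.Re (f (p1 u)))%:E) /\
  mu1.-integrable D1 (fun u => (w1 u * complex.Im (f (p1 u)))%:E).
Proof.
case: if1 => i1 i2; split.
  by apply: eq_integrable i1 => // x _ /=; rewrite complex_ReZ.
by apply: eq_integrable i2 => // x _ /=; rewrite complex_ImZ.
Qed.

Let ig2' : mu2.-integrable D2 (fun u => (w2 u * complex.Re (g (q2 u)))%:E) /\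
  mu2.-integrable D2 (fun u => (w2 u * complex.Im (g (q2 u)))%:E).
Proof.
case: ig2 => i1 i2; split.
  by apply: eq_integrable i1 => // x _ /=; rewrite complex_ReZ.
by apply: eq_integrable i2 => // x _ /=; rewrite complex_ImZ.
Qed.

Let ipf := product_formula_integrable mw mp mq w0 w10 w20 H.

Let ipfE :=
  product_formula_Rintegral mD mD1 mD2 mw mw1 mw2 mp mp1 mq mq2 w0 w10 w20 H.

(** The weights are real, so they commute with [complex.Re] and [complex.Im]; multiplying out
    [f * g] leaves four real instances of the formula. *)
Lemma product_formula_cintegral :
  cintegrable mu D (fun x => (w x)%:C * (f (p x) * g (q x))) /\
  cintegral mu D (fun x => (w x)%:C * (f (p x) * g (q x))) =
  cintegral mu1 D1 (fun u => (w1 u)%:C * f (p1 u)) *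
  cintegral mu2 D2 (fun v => (w2 v)%:C * g (q2 v)).
Proof.
case: if1' ig2' mf mg => f1 f2 [g1 g2] [mf1 mf2] [mg1 mg2].
have i11 := ipf mf1 mg1 f1 g1. have i12 := ipf mf1 mg2 f1 g2.
have i21 := ipf mf2 mg1 f2 g1. have i22 := ipf mf2 mg2 f2 g2.
split; first split.
- have := integrableB mD i11 i22; apply: eq_integrable => // x Dx /=.
  by rewrite complex_ReZ complex_ReM mulrBr EFinB.
- have := integrableD mD i12 i21; apply: eq_integrable => // x Dx /=.
  by rewrite complex_ImZ complex_ImM mulrDr EFinD.
rewrite /cintegral; simpc; congr (_ +i* _).
  under eq_Rintegral do rewrite complex_ReZ complex_ReM mulrBr.
  rewrite RintegralB//.
  rewrite (ipfE mf1 mg1 f1 g1) (ipfE mf2 mg2 f2 g2).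
  by congr (_ * _ - _ * _); apply: eq_Rintegral => x _; rewrite ?complex_ReZ ?complex_ImZ.
under eq_Rintegral do rewrite complex_ImZ complex_ImM mulrDr.
rewrite RintegralD//.
rewrite (ipfE mf1 mg2 f1 g2) (ipfE mf2 mg1 f2 g1).
by congr (_ * _ + _ * _); apply: eq_Rintegral => x _; rewrite ?complex_ReZ ?complex_ImZ.
Qed.

End bilinear_complex.

(** * Affine substitutions on the real line *)

Section lebesgue_affine.
Local Open Scope ereal_scope.
Context {R : realType}.
Local Notation leb := (@lebesgue_measure R).

Let aff (c b : R) : measurableTypeR R -> measurableTypeR R := fun x => (c * x + b)%R.

Let measurable_aff c b : measurable_fun setT (aff c b).
Proof. by apply: measurable_funD => //; apply: measurable_funM. Qed.

Let leb_aff c b : {measure set (measurableTypeR R) -> \bar R} :=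
  measure_function_pushforward__canonical__measure_function_Measure leb
    (measurable_aff c b).

(** The right-hand side is a measure in [A], namely a rescaled pushforward; it gives half-open
    intervals their length, and Lebesgue measure is the only one that does. *)
Lemma lebesgue_measure_affine (c b : R) (A : set R) : (0 < c)%R -> measurable A ->
  leb A = c%:E * leb ((fun x => c * x + b)%R @^-1` A).
Proof.
move=> c0 mA.
pose m := mscale (NngNum (ltW c0)) (leb_aff c b).
rewrite (lebesgue_measure_unique (mu := m))// => _ [[x y] _ <-].
change (leb `]x, y] = c%:E * leb (aff c b @^-1` `]x, y])).
rewrite (_ : _ @^-1` _ = `](x - b) / c, (y - b) / c]%classic)%R; last first.
  apply/seteqP; split=> t /=; rewrite !in_itv/= /aff;
    by rewrite ltr_pdivrMr// ler_pdivlMr// ltrBlDr lerBrDr mulrC.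
rewrite !lebesgue_measure_itv/= !lte_fin ltr_pM2r ?invr_gt0// ltrD2r.
case: ifPn => _; last by rewrite mule0.
rewrite -!EFinB -EFinM -mulrBl mulrC divfK ?gt_eqF//; congr EFin; ring.
Qed.

Lemma ge0_integral_affine (c b : R) (D : set R) (f : R -> \bar R) :
  (0 < c)%R -> measurable D -> measurable_fun D f -> (forall x, D x -> 0 <= f x) ->
  \int[leb]_(x in D) f x =
  c%:E * \int[leb]_(x in (fun x => c * x + b)%R @^-1` D) f (c * x + b)%R.
Proof.
move=> c0 mD mf f0.
have -> : \int[leb]_(x in (fun x => c * x + b)%R @^-1` D) f (c * x + b)%R =
    \int[pushforward leb (aff c b)]_(x in D) f x.
  rewrite ge0_integral_pushforward// => y /set_mem; exact: f0.
have := @ge0_integral_mscale _ _ R (leb_aff c b) D mD (NngNum (ltW c0)) f mf f0.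
move=> /= <-; apply: eq_measure_integral => A mA _.
exact: lebesgue_measure_affine.
Qed.

Lemma ge0_integral_scale_pos (c : R) (f : R -> \bar R) :
  (0 < c)%R -> measurable_fun (`]0%R, +oo[%classic : set R) f -> (forall x, (0 < x)%R -> 0 <= f x) ->
  \int[leb]_(x in `]0%R, +oo[%classic) f x = \int[leb]_(x in `]0%R, +oo[%classic) (c%:E * f (c * x)%R).
Proof.
move=> c0 mf f0; rewrite (ge0_integral_affine 0 c0)//; last first.
  by move=> x /=; rewrite in_itv/= andbT; exact: f0.
have -> : (fun x : R => (c * x + 0)%R) @^-1` `]0%R, +oo[ = `]0%R, +oo[%classic.
  by apply/seteqP; split => x /=; rewrite !in_itv/= !andbT addr0 pmulr_rgt0.
under eq_integral do rewrite addr0.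
rewrite ge0_integralZl//.
- apply: (measurable_comp (F := (`]0%R, +oo[%classic : set R))) => //.
    move=> y [x x0 <-]; move: x0 => /=; rewrite !in_itv/= !andbT => x0.
    by rewrite mulr_gt0.
- by move=> x /=; rewrite in_itv/= andbT => x0; rewrite f0// mulr_gt0.
- by rewrite lee_fin ltW.
Qed.

End lebesgue_affine.

(** Inversion is x times the power -1 of x^2, whose base is nonnegative; with the convention that
    the inverse of 0 is 0 the identity also holds at 0. *)
Lemma measurable_invr (R : realType) : measurable_fun setT (fun x : R => x^-1).
Proof.
rewrite (_ : (fun x => _) = (fun x : R => x * (x ^+ 2) `^ (-1))).
  apply: measurable_funM => //.
  exact: (measurableT_comp (@measurable_powR R (-1)) (exprn_measurable 2)).
apply/funext => x; rewrite powR_inv1 ?sqr_ge0// expr2.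
by have [->|x0] := eqVneq x 0; rewrite ?mul0r ?invr0// invfM mulrA divff ?mul1r.
Qed.

Lemma measurable_funV d (T : measurableType d) (R : realType) (f : T -> R) :
  measurable_fun setT f -> measurable_fun setT (fun x => (f x)^-1).
Proof. by move=> mf; apply: (measurableT_comp (@measurable_invr R)). Qed.

Lemma measurable_expRN d (T : measurableType d) (R : realType) (f : T -> R) :
  measurable_fun setT f -> measurable_fun setT (fun x => expR (- f x)).
Proof.
move=> mf; apply: (measurableT_comp (@measurable_expR R)).
exact: measurableT_comp.
Qed.

Local Ltac nng :=
  repeat first [exact: expR_ge0 | apply: exprn_ge0 | apply: mulr_ge0
    | rewrite invr_ge0]; try exact: ltW; try done.

(** * Polar coordinates from dilations, for nonnegative integrands *)

Section polar.
Local Open Scope ereal_scope.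
Context d (T : measurableType d) (R : realType)
  (mu : {sigma_finite_measure set T -> \bar R}) (dil : R -> T -> T) (n : nat).
Local Notation leb := (@lebesgue_measure R).
Local Notation pos := (`]0%R, +oo[%classic : set R).

Hypothesis mdil : forall s, measurable_fun setT (dil s).
Hypothesis scale : forall s, (0 < s)%R -> forall f : T -> \bar R,
  measurable_fun setT f -> (forall x, 0 <= f x) ->
  \int[mu]_x f x = (s ^+ n.+1)%:E * \int[mu]_x f (dil s x).

Variables (q h : T -> R) (g : R -> R).
Hypotheses (mq : measurable_fun setT q) (mh : measurable_fun setT h)
  (mg : measurable_fun setT g).
Hypothesis q_dil : forall s x, (0 < s)%R -> q (dil s x) = (s * q x)%R.
Hypothesis h_dil : forall s x, (0 < s)%R -> h (dil s x) = h x.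
Hypothesis h0 : forall x, (0 <= h x)%R.
Hypothesis g0 : forall x, (0 <= g x)%R.
Hypothesis hq : forall x, h x != 0%R -> (0 < q x)%R.

Let K := \int[leb]_(v in pos) (v^-1 ^+ n.+2 * expR (- v^-1))%:E.

(** Scaling the radial variable by [q x] is legitimate only in the second case; in the first one
    both integrands vanish. *)
Let hqP x : h x = 0%R \/ (0 < q x)%R.
Proof. by have [->|/hq] := eqVneq (h x) 0%R; [left|right]. Qed.

Let mgq : measurable_fun setT (fun x => g (q x)).
Proof. exact: measurableT_comp. Qed.

(** [F1] is the integrand once u = q(x) v has been substituted; [F2] is what it becomes after
    dilating x by 1 / v. *)
Let F1 (z : T * R) : \bar R :=
  (h z.1 * expR (- q z.1) * q z.1 ^+ n.+1 * z.2 ^+ n * g (q z.1 * z.2))%:E.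

Let F2 (z : T * R) : \bar R :=
  (h z.1 * g (q z.1) * (q z.1 ^+ n.+1 * z.2^-1 ^+ n.+2 * expR (- (q z.1 / z.2))))%:E.

Let mfst (f : T -> R) : measurable_fun setT f ->
  measurable_fun setT (fun z : T * R => f z.1).
Proof. by move=> mf; apply: measurableT_comp. Qed.

Let mF1 : measurable_fun setT F1.
Proof.
apply/measurable_EFinP; apply: measurable_funM.
  apply: measurable_funM; last exact: measurable_funX.
  apply: measurable_funM; last by apply: measurable_funX; exact: mfst.
  by apply: measurable_funM; [exact: mfst|apply: measurable_expRN; exact: mfst].
apply: (measurableT_comp mg); apply: measurable_funM => //; exact: mfst.
Qed.

Let mF2 : measurable_fun setT F2.
Proof.
apply/measurable_EFinP; apply: measurable_funM.
  by apply: measurable_funM; [exact: mfst|exact: (mfst mgq)].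
apply: measurable_funM.
  apply: measurable_funM; first by apply: measurable_funX; exact: mfst.
  by apply: measurable_funX; exact: measurable_funV.
apply: measurable_expRN; apply: measurable_funM; first exact: mfst.
exact: measurable_funV.
Qed.

Let F1_ge0 x y : (0 < y)%R -> 0 <= F1 (x, y).
Proof.
move=> /ltW y0; rewrite lee_fin /=; have [->|/ltW qx] := hqP x.
  by rewrite !mul0r.
by nng.
Qed.

Let F2_ge0 x y : (0 < y)%R -> 0 <= F2 (x, y).
Proof.
move=> /ltW y0; rewrite lee_fin /=; have [->|/ltW qx] := hqP x.
  by rewrite !mul0r.
by nng.
Qed.

Let posP (x : R) : pos x -> (0 < x)%R.
Proof. by rewrite /= in_itv/= andbT. Qed.

(* Polar coordinates without a surface measure: substituting u = q(x) v, dilating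
   by 1 / v and substituting v = q(x) v', with Tonelli in between, turns the
   right-hand side into the left-hand one. *)
Lemma polar_aux : K * \int[mu]_x (h x * g (q x))%:E =
  \int[mu]_x (h x * expR (- q x))%:E * \int[leb]_(u in pos) (u ^+ n * g u)%:E.
Proof.
have mug : measurable_fun setT (fun u : R => (u ^+ n * g u)%:E).
  by apply/measurable_EFinP; apply: measurable_funM => //; exact: measurable_funX.
have mhe : measurable_fun setT (fun x => (h x * expR (- q x))%:E).
  by apply/measurable_EFinP; apply: measurable_funM => //; exact: measurable_expRN.
have ug0 (u : R) : pos u -> 0 <= (u ^+ n * g u)%:E.
  by move=> /posP/ltW u0; rewrite lee_fin mulr_ge0// ?exprn_ge0.
apply/esym; rewrite -ge0_integralZr//; last 2 first.
- by move=> x _; rewrite lee_fin mulr_ge0// expR_ge0.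
- exact: integral_ge0.
transitivity (\int[mu]_x \int[leb]_(v in pos) F1 (x, v)).
  apply: eq_integral => x _.
  rewrite -ge0_integralZl//; last 2 first.
  - exact: measurable_funTS.
  - by rewrite lee_fin mulr_ge0// expR_ge0.
  have [hx|qx] := hqP x.
    by apply: eq_integral => v _; rewrite /F1/= hx !mul0r mul0e.
  rewrite [LHS](ge0_integral_scale_pos qx)//; last 2 first.
  - by apply: measurable_funTS; exact: measurable_funeM.
  - by move=> v /ltW v0; rewrite mule_ge0// lee_fin; nng.
  apply: eq_integral => v _; rewrite /F1/= -!EFinM; congr EFin.
  by rewrite exprMn exprS; ring.
rewrite (@fubini_tonelli_set _ _ _ _ _ mu leb setT pos measurableT _ F1)//; last 2 first.
- exact: measurable_funTS.
- by move=> x y _ /posP; exact: F1_ge0.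
transitivity (\int[leb]_(v in pos) \int[mu]_x F2 (x, v)).
  apply: eq_integral => v /set_mem/posP v0.
  rewrite (scale (s := v^-1%R)) ?invr_gt0//; last 2 first.
  - exact: (measurable_fun_pair1 v mF1).
  - by move=> x; exact: F1_ge0.
  rewrite -ge0_integralZl//; last 3 first.
  - exact: (measurableT_comp (measurable_fun_pair1 v mF1) (mdil v^-1%R)).
  - by move=> x _; exact: F1_ge0.
  - by rewrite lee_fin exprn_ge0// invr_ge0 ltW.
  apply: eq_integral => x _; rewrite /F1 /F2/= q_dil ?invr_gt0// h_dil ?invr_gt0//.
  rewrite -!EFinM; congr EFin.
  have -> : (v^-1 * q x * v = q x)%R by field; exact: lt0r_neq0.
  have -> : (v^-1 * q x = q x / v)%R by rewrite mulrC.
  (* The measure and the factor [q x ^+ n.+1] each contribute v^(-(n+1)) under the dilation; the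
     radial weight v^n leaves v^(-(n+2)). *)
  have -> : (v^-1 ^+ n.+2 = v^-1 ^+ n.+1 * v^-1 ^+ n.+1 * v ^+ n)%R.
    rewrite (exprSr _ n.+1) -[RHS]mulrA; congr (_ * _)%R.
    by rewrite exprS -mulrA -exprMn mulVf ?expr1n ?mulr1// lt0r_neq0.
  by rewrite exprMn; ring.
rewrite -(@fubini_tonelli_set _ _ _ _ _ mu leb setT pos measurableT _ F2)//; last 2 first.
- exact: measurable_funTS.
- by move=> x y _ /posP; exact: F2_ge0.
rewrite muleC -ge0_integralZr//; last 3 first.
- by apply/measurable_EFinP; exact: measurable_funM.
- by move=> x _; rewrite lee_fin; nng.
- by apply: integral_ge0 => v /posP/ltW v0; rewrite lee_fin; nng.
apply: eq_integral => x _.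
rewrite -ge0_integralZl//; last 3 first.
- apply: measurable_funTS; apply/measurable_EFinP; apply: measurable_funM.
    by apply: measurable_funX; exact: measurable_invr.
  by apply: measurable_expRN; exact: measurable_invr.
- by move=> v /posP/ltW v0; rewrite lee_fin; nng.
- by rewrite lee_fin; nng.
have [hx|qx] := hqP x.
  by apply: eq_integral => v _; rewrite /F2/= hx !mul0r mul0e.
rewrite [LHS](ge0_integral_scale_pos qx)//; last 2 first.
- by apply: measurable_funTS; exact: (measurable_fun_pair2 x mF2).
- by move=> v; exact: F2_ge0.
apply: eq_integral => v /set_mem/posP v0; rewrite /F2/= -!EFinM; congr EFin.
have -> : (q x / (q x * v) = v^-1)%R by field; rewrite !lt0r_neq0.
have qE : (q x * q x ^+ n.+1 * (q x)^-1 ^+ n.+2 = 1)%R.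
  by rewrite -exprS -exprMn divff ?expr1n// lt0r_neq0.
rewrite invfM exprMn -[RHS]mulr1 -qE.
move: (q x ^+ _)%R (_^-1 ^+ _)%R (_^-1 ^+ _)%R (expR _) => a b c e; ring.
Qed.

End polar.

(** * Integrals over the positive half-line from a primitive *)

Section improper.
Context {R : realType}.
Local Notation leb := (@lebesgue_measure R).
Local Notation pos := (`]0%R, +oo[%classic : set R).
Local Notation Icc n := (`[expR (- n%:R), expR n%:R]%classic : set R).

Lemma FTC_pos (F f : R -> R) (a b : R) : 0 < a -> a < b ->
  (forall t : R, 0 < t -> is_derive t 1 F (f t)) ->
  (forall t : R, 0 < t -> {for t, continuous f}) ->
  (\int[leb]_(t in `[a, b]) (f t)%:E = (F b)%:E - (F a)%:E)%E.
Proof.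
move=> a0 ab dF cf.
have cF t : 0 < t -> {for t, continuous F}.
  move=> /dF dFt; apply: differentiable_continuous; apply/derivable1_diffP.
  exact: ex_derive.
apply: continuous_FTC2 => //.
- apply: continuous_in_subspaceT => x; rewrite inE/= in_itv/= => /andP[ax _].
  by apply: cf; exact: lt_le_trans ax.
- split.
  + move=> x; rewrite in_itv/= => /andP[ax _].
    by have := dF x (lt_trans a0 ax) => ?; exact: ex_derive.
  + by apply: cvg_at_right_filter; exact: cF.
  + by apply: cvg_at_left_filter; apply: cF; exact: lt_trans ab.
- move=> x; rewrite in_itv/= => /andP[ax _].
  by have := dF x (lt_trans a0 ax) => ?; rewrite derive1E; exact: derive_val.
Qed.

(** With exponential endpoints [ln] takes the values n and - n there, so boundary terms of
    primitives written with [ln t] are explicit. *)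
Lemma bigcup_Icc : \bigcup_n Icc n = pos.
Proof.
apply/seteqP; split=> [x [n _]|x] /=; rewrite !in_itv/=.
  by move=> /andP[+ _]; rewrite andbT; apply: lt_le_trans; exact: expR_gt0.
rewrite andbT => x0.
pose n := (Num.truncn `|ln x|).+1.
exists n => //=; rewrite in_itv/= -[x in X in X && _]lnK ?posrE//.
rewrite -[x in X in _ && X]lnK ?posrE// !ler_expR -ler_norml.
exact/ltW/truncnS_gt.
Qed.

(** At n = 0 the interval is the single point 1, which the fundamental theorem on a < b does not
    cover. *)
Lemma Icc_lt n : expR (- n%:R) < expR n%:R :> R \/ n = 0%N.
Proof.
case: n => [|n]; [by right|left].
by rewrite ltr_expR (@lt_trans _ _ 0)// ?ltr0n// oppr_lt0 ltr0n.
Qed.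

Lemma FTC_Icc (F f : R -> R) n :
  (forall t : R, 0 < t -> is_derive t 1 F (f t)) ->
  (forall t : R, 0 < t -> {for t, continuous f}) ->
  (\int[leb]_(t in Icc n) (f t)%:E = (F (expR n%:R))%:E - (F (expR (- n%:R)))%:E)%E.
Proof.
move=> dF cf; have [nn|->] := Icc_lt n; first exact: FTC_pos (expR_gt0 _) _ _ _.
by rewrite oppr0 set_itv1 integral_set1 subee.
Qed.

(** Monotone convergence along the exhaustion. Since only finiteness is wanted, bounds on the
    primitive replace its limits at 0 and infinity. *)
Lemma ge0_integral_pos_le (F f : R -> R) (M : R) :
  (forall t : R, 0 < t -> is_derive t 1 F (f t)) ->
  (forall t : R, 0 < t -> {for t, continuous f}) ->
  measurable_fun pos f ->
  (forall t : R, 0 < t -> 0 <= f t) -> (forall t : R, 0 < t -> 0 <= F t <= M) ->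
  (\int[leb]_(t in pos) (f t)%:E <= M%:E)%E.
Proof.
move=> dF cf mf f0 FM.
rewrite -bigcup_Icc.
have Ipos n x : Icc n x -> 0 < x.
  by rewrite /= in_itv/= => /andP[+ _]; apply: lt_le_trans; exact: expR_gt0.
have : (\int[leb]_(t in Icc n) (f t)%:E @[n --> \oo] -->
   \int[leb]_(t in \bigcup_n Icc n) (f t)%:E)%E.
  apply: ge0_nondecreasing_set_cvg_integral.
  - move=> m n mn; rewrite subsetEset => x /=; rewrite !in_itv/= => /andP[xm mx].
    rewrite (le_trans _ xm)/= ?(le_trans mx)// ler_expR ?lerN2 ler_nat//.
  - by move=> n; exact: measurable_itv.
  - move=> n; apply/measurable_EFinP; apply: measurable_funS mf => //.
    by move=> x /Ipos x0; rewrite /= in_itv/= x0.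
  - by move=> n x /Ipos x0; rewrite lee_fin f0.
move=> c; rewrite -(cvg_lim _ c)//; apply: lime_le.
  by apply/cvg_ex; eexists; exact: c.
near=> n; rewrite (FTC_Icc _ dF cf) -EFinB lee_fin lerBlDr.
have /andP[_ h1] := FM _ (expR_gt0 n%:R); have /andP[h2 _] := FM _ (expR_gt0 (- n%:R)).
by rewrite (le_trans h1)// lerDl.
Unshelve. all: by end_near. Qed.

(** Here [f] may change sign, so the truncations to [Icc n] pass to the limit by dominated
    convergence, with [f] itself in absolute value as majorant. *)
Lemma integral_pos_eq0 (F f : R -> R) :
  (forall t : R, 0 < t -> is_derive t 1 F (f t)) ->
  (forall t : R, 0 < t -> {for t, continuous f}) ->
  leb.-integrable pos (EFin \o f) ->
  F (expR n%:R) @[n --> \oo] --> (0 : R) ->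
  F (expR (- n%:R)) @[n --> \oo] --> (0 : R) ->
  (\int[leb]_(t in pos) (f t)%:E = 0)%E.
Proof.
move=> dF cf intf Fy F0.
have mpos : measurable pos by [].
have mI n : measurable (Icc n) by exact: measurable_itv.
have /integrableP[mf _] := intf.
have Isub n : Icc n `<=` pos by rewrite -bigcup_Icc; move=> x xn; exists n.
have mf_ n : measurable_fun pos ((EFin \o f) \_ (Icc n)).
  apply: (measurable_restrict (EFin \o f) (mI n) mpos).1.
  by apply: measurable_funS mf => // x [].
have f_f : \forall x \ae leb, pos x ->
    ((EFin \o f) \_ (Icc n)) x @[n --> \oo] --> (EFin \o f) x.
  apply/aeW => x; rewrite -bigcup_Icc => -[m _ xm].
  apply: cvg_near_cst; exists m => // n /= mn.
  rewrite patchE mem_set// /= in_itv/=; move: xm; rewrite /= in_itv/= => /andP[xm mx].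
  by rewrite (le_trans _ xm)/= ?(le_trans mx)// ler_expR ?lerN2 ler_nat.
have f_g : \forall x \ae leb, forall n, pos x ->
    (`|((EFin \o f) \_ (Icc n)) x| <= (abse \o (EFin \o f)) x)%E.
  by apply/aeW => x n _; rewrite patchE; case: ifPn => // _; rewrite abse0 abse_ge0.
have [_ _ cv] :=
  @dominated_convergence _ _ R leb pos mpos _ _ _ mf_ mf f_f (integrable_abse intf) f_g.
rewrite -(cvg_lim _ cv)//; apply/cvg_lim => //.
rewrite (_ : (fun _ => _) = fun n => (F (expR n%:R) - F (expR (- n%:R)))%:E).
  apply: cvg_EFin; first by near=> n.
  by rewrite -[X in _ --> X](subr0 0); apply: cvgB.
apply/funext => n; rewrite EFinB -(FTC_Icc _ dF cf) /=.
by rewrite -integral_mkcondr setIC (setIidl (Isub n)).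
Unshelve. all: by end_near. Qed.

End improper.

(** * Complex powers and the Gamma function *)

Section cpow_theory.
Context {R : realType}.
Implicit Types (a b : R[i]) (x y : R).

Lemma cpowD x a b : cpow x (a + b) = cpow x a * cpow x b.
Proof.
case: a b => a1 a2 [b1 b2]; rewrite /cpow /=; simpc.
rewrite !mulrDl expRD cosD sinD; congr (_ +i* _); ring.
Qed.

Lemma cpowM x y a : 0 < x -> 0 < y -> cpow (x * y) a = cpow x a * cpow y a.
Proof.
move=> x0 y0; case: a => a1 a2; rewrite /cpow /=; simpc.
rewrite lnM ?posrE// !mulrDr expRD cosD sinD; congr (_ +i* _); ring.
Qed.

Lemma cpow_realr x (r : R) : cpow x r%:C = (expR (r * ln x))%:C.
Proof. by rewrite /cpow /= mul0r cos0 sin0; simpc. Qed.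

Lemma cpow_0r x : cpow x 0 = 1.
Proof. by rewrite -[0]/(0%:C) cpow_realr mul0r expR0. Qed.

Lemma cpow_natr x n : 0 < x -> cpow x n%:R = (x ^+ n)%:C.
Proof.
move=> x0; rewrite -(rmorph_nat (real_complex R)) cpow_realr.
by rewrite mulr_natl -lnXn// lnK// posrE exprn_gt0.
Qed.

Lemma cpow_1r x : 0 < x -> cpow x 1 = x%:C.
Proof. by move=> x0; rewrite (cpow_natr 1 x0) expr1. Qed.

Lemma cpowNr x a : cpow x (- a) * cpow x a = 1.
Proof. by rewrite -cpowD addNr cpow_0r. Qed.

Lemma Re_cpow x a : complex.Re (cpow x a) =
  expR (complex.Re a * ln x) * cos (complex.Im a * ln x).
Proof. by rewrite /cpow complex_ReZ. Qed.

Lemma Im_cpow x a : complex.Im (cpow x a) =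
  expR (complex.Re a * ln x) * sin (complex.Im a * ln x).
Proof. by rewrite /cpow complex_ImZ. Qed.

Lemma Re_cpow_le x a : `|complex.Re (cpow x a)| <= expR (complex.Re a * ln x).
Proof. by rewrite Re_cpow normrM (ger0_norm (expR_ge0 _)) ler_piMr ?expR_ge0// cos_max. Qed.

Lemma Im_cpow_le x a : `|complex.Im (cpow x a)| <= expR (complex.Re a * ln x).
Proof. by rewrite Im_cpow normrM (ger0_norm (expR_ge0 _)) ler_piMr ?expR_ge0// sin_max. Qed.

Lemma cmeasurable_cpow a : cmeasurable (fun x => cpow x a).
Proof.
have mRe : measurable_fun setT (fun x => expR (complex.Re a * ln x)).
  apply: (measurableT_comp (@measurable_expR R)).
  by apply: measurable_funM => //; exact: measurable_ln.
have mIm : measurable_fun setT (fun x => complex.Im a * ln x).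
  by apply: measurable_funM => //; exact: measurable_ln.
split; [under eq_fun do rewrite Re_cpow|under eq_fun do rewrite Im_cpow].
  apply: measurable_funM => //; apply: measurableT_comp => //.
  by apply: continuous_measurable_fun; exact: continuous_cos.
apply: measurable_funM => //; apply: measurableT_comp => //.
by apply: continuous_measurable_fun; exact: continuous_sin.
Qed.

Lemma cintegrable_le d (T : measurableType d) (mu : {measure set T -> \bar R})
    (D : set T) (f : T -> R[i]) (g : T -> R) : measurable D ->
  cmeasurable f -> mu.-integrable D (EFin \o g) ->
  (forall w, D w -> `|complex.Re (f w)| <= g w /\ `|complex.Im (f w)| <= g w) ->
  cintegrable mu D f.
Proof.
move=> mD [mf1 mf2] ig fg; split; apply: le_integrable ig => //.
- exact/measurable_EFinP/measurable_funTS.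
- by move=> x /fg[+ _]; rewrite /= lee_fin => /le_trans; apply; exact: ler_norm.
- exact/measurable_EFinP/measurable_funTS.
- by move=> x /fg[_ +]; rewrite /= lee_fin => /le_trans; apply; exact: ler_norm.
Qed.

End cpow_theory.

Section beta_integrand.
Context {R : realType}.
Local Notation leb := (@lebesgue_measure R).
Local Notation pos := (`]0%R, +oo[%classic : set R).
Implicit Types x t : R.

Lemma expR_lnB1 x t : 0 < t -> expR ((x - 1) * ln t) = expR (x * ln t) / t.
Proof. by move=> t0; rewrite mulrBl mul1r expRD expRN lnK. Qed.

(* The derivative of (t / (1 + t)) ^ x / x, an integrable majorant of
   t ^ (x - 1) e^(-t) up to a constant. *)
Definition beta_int x t :=
  expR (x * (ln t - ln (1 + t))) * (t^-1 - (1 + t)^-1).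

Lemma measurable_beta_int x : measurable_fun pos (beta_int x).
Proof.
apply: measurable_funTS; apply: measurable_funM.
  apply: (measurableT_comp (@measurable_expR R)); apply: measurable_funM => //.
  apply: measurable_funB; first exact: measurable_ln.
  by apply: (measurableT_comp (@measurable_ln R)); exact: measurable_funD.
apply: measurable_funB; first exact: measurable_invr.
by apply: measurable_funV; exact: measurable_funD.
Qed.

Lemma ge0_integral_beta_int x : 0 < x ->
  (\int[leb]_(t in pos) (beta_int x t)%:E <= (x^-1)%:E)%E.
Proof.
move=> x0.
apply: (@ge0_integral_pos_le _ (fun t => x^-1 * expR (x * (ln t - ln (1 + t))))).
- move=> t t0.
  have t1 : 0 < 1 + t by rewrite addr_gt0.
  have d1 : is_derive t 1 (@ln R) t^-1 by exact: is_derive1_ln.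
  have d2 : is_derive (1 + t) 1 (@ln R) (1 + t)^-1 by exact: is_derive1_ln.
  have d3 : is_derive t 1 (fun t => 1 + t) 1.
    have : is_derive t 1 (cst 1 + id) (0 + 1) by exact: is_deriveD.
    by rewrite add0r.
  have d4 := @is_derive1_comp _ (@ln R) (fun t => 1 + t) t _ _ d2 d3.
  have d5 := is_deriveB d1 d4.
  have d6 := is_deriveZ x d5.
  have d7 := @is_derive1_comp _ (@expR R) _ t _ _ (is_derive_expR _) d6.
  have d8 := is_deriveZ x^-1 d7.
  apply: (@is_derive_eq _ _ _ _ _ _ _ _ d8).
  rewrite /beta_int /= /GRing.scale /= mulr1.
  rewrite mulrCA (mulrA x^-1) mulVf ?mul1r ?gt_eqF//.
- move=> t t0.
  have t1 : 0 < 1 + t by rewrite addr_gt0.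
  have c1 : 1 + s @[s --> t] --> 1 + t by apply: cvgD => //; exact: cvg_cst.
  apply: cvgM.
    apply: continuous_cvg; first exact: continuous_expR.
    apply: cvgM; first exact: cvg_cst.
    apply: cvgB; first exact: continuous_ln.
    by apply: continuous_cvg => //; exact: continuous_ln.
  by apply: cvgB; apply: cvgV => //; rewrite gt_eqF.
- exact: measurable_beta_int.
- move=> t t0; rewrite mulr_ge0 ?expR_ge0// subr_ge0 lef_pV2 ?posrE ?addr_gt0//.
  by rewrite lerDr.
- move=> t t0; rewrite mulr_ge0 ?expR_ge0 ?invr_ge0 ?(ltW x0)//=.
  rewrite ler_piMr ?invr_ge0 ?(ltW x0)// -expR0 ler_expR mulr_ge0_le0 ?(ltW x0)//.
  by rewrite subr_le0 ler_ln ?posrE ?addr_gt0// lerDr.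
Qed.

End beta_integrand.

Section gamma.
Context {R : realType}.
Local Notation leb := (@lebesgue_measure R).
Local Notation pos := (`]0%R, +oo[%classic : set R).
Implicit Types x t : R.

Lemma posP t : pos t -> 0 < t.
Proof. by rewrite /= in_itv/= andbT. Qed.

(** The tangent line of [ln] at A, times A. In exponential form: u^A e^(-u) is largest at u = A. *)
Lemma ln_le_linear (A u : R) : 0 < A -> 0 < u -> A * ln u <= u - A + A * ln A.
Proof.
move=> A0 u0.
have : ln (u / A) <= u / A - 1.
  have := @le_ln1Dx R (u / A - 1); rewrite (addrC 1) subrK; apply.
  by rewrite ltrBrDr addNr divr_gt0.
rewrite ln_div ?posrE// lerBlDr => h.
have := ler_wpM2l (ltW A0) h; rewrite mulrDr mulrBr mulr1 mulrCA divff ?gt_eqF//.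
by rewrite mulr1.
Qed.

Lemma integrable_gamma x : 0 < x ->
  leb.-integrable pos (EFin \o (fun t => expR ((x - 1) * ln t) * expR (- t))).
Proof.
move=> x0.
have mg : measurable_fun pos (fun t => expR ((x - 1) * ln t) * expR (- t)).
  apply: measurable_funTS; apply: measurable_funM.
    apply: (measurableT_comp (@measurable_expR R)).
    by apply: measurable_funM => //; exact: measurable_ln.
  exact: measurable_expRN.
apply/integrableP; split; first exact/measurable_EFinP.
(* Since [beta_int x t] equals t^(x-1) (1 + t)^(-(x+1)), the constant must dominate (1 + t)^A
   e^(-t); [ln_le_linear] at u = 1 + t gives exactly this [C]. *)
pose A := x + 1; pose C := expR (1 - A + A * ln A).
have A0 : 0 < A by rewrite addr_gt0.
apply: (@le_lt_trans _ _ (\int[leb]_(t in pos) (C%:E * (beta_int x t)%:E))%E).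
  apply: ge0_le_integral => //.
  - by apply/measurable_EFinP; exact: measurableT_comp.
  - apply: measurable_funeM; apply/measurable_EFinP; exact: measurable_beta_int.
  move=> t /posP t0; rewrite abse_EFin -EFinM lee_fin ger0_norm ?mulr_ge0 ?expR_ge0//.
  have t1 : 0 < 1 + t by rewrite addr_gt0.
  rewrite /beta_int [x * (_ - _)]mulrBr expRD (expRN (x * ln (1 + t))) expR_lnB1//.
  have -> : t^-1 - (1 + t)^-1 = t^-1 * (1 + t)^-1.
    by field; rewrite !gt_eqF.
  have -> : C * (expR (x * ln t) * (expR (x * ln (1 + t)))^-1 * (t^-1 * (1 + t)^-1)) =
      expR (x * ln t) / t * (C / (expR (x * ln (1 + t)) * (1 + t))).
    by rewrite invfM; ring.
  rewrite ler_wpM2l ?divr_ge0 ?expR_ge0 ?(ltW t0)//.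
  rewrite -[X in _ / (_ * X)]lnK ?posrE// -expRD -expRN -expRD ler_expR.
  have := ln_le_linear A0 t1; rewrite {1}/A; lra.
rewrite ge0_integralZl//; last 3 first.
- by apply/measurable_EFinP; exact: measurable_beta_int.
- move=> t /posP t0; rewrite lee_fin mulr_ge0 ?expR_ge0// subr_ge0.
  by rewrite lef_pV2 ?posrE ?addr_gt0// lerDr.
- by rewrite lee_fin expR_ge0.
rewrite lte_mul_pinfty ?lee_fin ?expR_ge0//.
by rewrite (le_lt_trans (ge0_integral_beta_int x0))// ltry.
Qed.

Definition gamma_int (a : R[i]) t := cpow t (a - 1) * (expR (- t))%:C.

Lemma cmeasurable_gamma a : cmeasurable (gamma_int a).
Proof.
apply: cmeasurableM; first exact: cmeasurable_cpow.
by apply: cmeasurable_real; exact: measurable_expRN.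
Qed.

Lemma cintegrable_gamma a : 0 < complex.Re a -> cintegrable leb pos (gamma_int a).
Proof.
move=> a0; apply: cintegrable_le (integrable_gamma a0) _ => //.
  exact: cmeasurable_gamma.
have ReB : complex.Re a - 1 = complex.Re (a - 1) by case: a {a0}.
move=> t _; rewrite /gamma_int ReB (mulrC _ (expR (- t))%:C) complex_ReZ complex_ImZ !normrM.
rewrite (ger0_norm (expR_ge0 (- t))) (mulrC _ (expR (- t))).
by split; rewrite ler_wpM2l ?expR_ge0 ?Re_cpow_le ?Im_cpow_le.
Qed.

(* G is t ^ x e^(-t) times the real part of e^(i (y ln t + phi)); the cases
   phi = 0 and phi = - pi / 2 are the real and imaginary parts of the
   integration by parts behind [cGammaS]. *)
Let G x y phi t := expR (x * ln t - t) * cos (y * ln t + phi).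
Let g x y phi t := expR (x * ln t - t) *
  ((x / t - 1) * cos (y * ln t + phi) - y / t * sin (y * ln t + phi)).

Let is_derive_G x y phi t : 0 < t -> is_derive t 1 (G x y phi) (g x y phi t).
Proof.
move=> t0.
have d1 : is_derive t 1 (@ln R) t^-1 by exact: is_derive1_ln.
have d2 := is_deriveB (is_deriveZ x d1) (is_derive_id t 1).
have d3 := @is_derive1_comp _ (@expR R) _ t _ _ (is_derive_expR _) d2.
have d4 := is_deriveD (is_deriveZ y d1) (is_derive_cst phi t 1).
have d5 := @is_derive1_comp _ (@cos R) _ t _ _ (is_derive_cos _) d4.
have d6 := is_deriveM d3 d5.
apply: (@is_derive_eq _ _ _ _ _ _ _ _ d6).
rewrite /g /= /GRing.scale /=; ring.
Qed.

Let continuous_g x y phi t : 0 < t -> {for t, continuous (g x y phi)}.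
Proof.
move=> t0.
have cl : ln s @[s --> t] --> ln t by exact: continuous_ln.
have cy : y * ln s + phi @[s --> t] --> y * ln t + phi.
  by apply: cvgD; [apply: cvgM => //; exact: cvg_cst|exact: cvg_cst].
have cV : s^-1 @[s --> t] --> t^-1 by apply: cvgV => //; rewrite gt_eqF.
apply: cvgM.
  apply: continuous_cvg; first exact: continuous_expR.
  by apply: cvgB => //; apply: cvgM => //; exact: cvg_cst.
apply: cvgB; apply: cvgM.
- by apply: cvgB; [apply: cvgM => //; exact: cvg_cst|exact: cvg_cst].
- by apply: continuous_cvg => //; exact: continuous_cos.
- by apply: cvgM => //; exact: cvg_cst.
- by apply: continuous_cvg => //; exact: continuous_sin.
Qed.

Lemma cvg0_le_expRN (u : R ^nat) (C c : R) : 0 < c ->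
  (forall n, `|u n| <= C * expR (- (c * n%:R))) -> u n @[n --> \oo] --> (0 : R).
Proof.
move=> c0 uC.
have cv : C * expR (- (c * n%:R)) @[n --> \oo] --> (0 : R).
  rewrite (_ : (fun n => _) = (fun n => C * (expR (- c)) ^+ n)); last first.
    by apply/funext => n; rewrite -expRM_natr mulNr.
  rewrite -[X in _ --> X](mulr0 C); apply: cvgM; first exact: cvg_cst.
  by apply: cvg_expr; rewrite ger0_norm ?expR_ge0// -expR0 ltr_expR oppr_lt0.
have cvN : - (C * expR (- (c * n%:R))) @[n --> \oo] --> (0 : R).
  by rewrite -[X in _ --> X]oppr0; exact: cvgN.
by apply: squeeze_cvgr cvN cv; near=> n; rewrite -ler_norml.
Unshelve. all: by end_near. Qed.

Let integral_g x y phi : 0 < x -> leb.-integrable pos (EFin \o g x y phi) ->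
  (\int[leb]_(t in pos) (g x y phi t)%:E = 0)%E.
Proof.
move=> x0 ig; apply: (@integral_pos_eq0 _ (G x y phi)) => //.
- by move=> t; exact: is_derive_G.
- by move=> t; exact: continuous_g.
(* At t = e^n the modulus is at most exp (x n - e^n). The tangent bound with A = x + 1, rather than
   x, leaves a spare factor e^(-n). *)
- apply: (@cvg0_le_expRN _ (expR (- (x + 1) + (x + 1) * ln (x + 1))) 1) => // n.
  rewrite /G expRK normrM ger0_norm ?expR_ge0//.
  rewrite (le_trans (ler_piMr (expR_ge0 _) (cos_max _)))// -expRD ler_expR.
  have := @ln_le_linear (x + 1) (expR n%:R) _ (expR_gt0 _).
  by rewrite expRK addr_gt0// => /(_ isT); lra.
(* At t = e^(-n) the decay is that of t^x, of rate x > 0. *)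
- apply: (@cvg0_le_expRN _ 1 x) => // n.
  rewrite /G expRK normrM ger0_norm ?expR_ge0//.
  rewrite (le_trans (ler_piMr (expR_ge0 _) (cos_max _)))// mul1r ler_expR.
  by rewrite mulrN gerBl expR_ge0.
Qed.

Lemma cGammaE (a : R[i]) : cGamma a = cintegral leb pos (gamma_int a).
Proof. by []. Qed.

Lemma cGammaS (a : R[i]) : 0 < complex.Re a -> cGamma (a + 1) = a * cGamma a.
Proof.
move=> a0.
have aS0 : 0 < complex.Re (a + 1) by case: a a0 => x y /= x0; rewrite addr_gt0.
have mpos : measurable (pos : set (measurableTypeR R)) by [].
have ia := cintegrable_gamma a0.
have ia1 := cintegrable_gamma aS0.
have iaa := cintegrableZ a mpos ia.
rewrite !cGammaE -cintegralZ// /cintegral.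
have gint1 t : 0 < t -> gamma_int (a + 1) t = t%:C * gamma_int a t.
  move=> t0; rewrite /gamma_int mulrA; congr (_ * _).
  by rewrite addrAC (cpowD t (a - 1) 1) cpow_1r// mulrC.
have gE phi t : 0 < t -> g (complex.Re a) (complex.Im a) phi t =
  expR ((complex.Re a - 1) * ln t) * expR (- t) *
  ((complex.Re a - t) * cos (complex.Im a * ln t + phi) - complex.Im a * sin (complex.Im a * ln t + phi)).
  move=> t0; rewrite /g expRD expR_lnB1//.
  move: (cos _) (sin _) (expR _) (expR _) => c s e e'; field; exact: lt0r_neq0.
have gRe t : 0 < t -> complex.Re (a * gamma_int a t) - complex.Re (gamma_int (a + 1) t) =
    g (complex.Re a) (complex.Im a) 0 t.
  move=> t0; rewrite gint1// gE// !addr0 /gamma_int.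
  have := (Re_cpow t (a - 1), Im_cpow t (a - 1)); move: (cpow t _) => P [].
  rewrite !(complex_ReM, complex_ImM) => -> ->; case: a {a0 aS0 ia ia1 iaa gint1 gE} => x y /=; rewrite subr0; ring.
have gIm t : 0 < t -> complex.Im (a * gamma_int a t) - complex.Im (gamma_int (a + 1) t) =
    g (complex.Re a) (complex.Im a) (- (pi / 2)) t.
  move=> t0; rewrite gint1// gE// /gamma_int.
  have := (Re_cpow t (a - 1), Im_cpow t (a - 1)); move: (cpow t _) => P [].
  rewrite !(complex_ReM, complex_ImM) => -> ->; rewrite cosBpihalf sinBpihalf.
  case: a {a0 aS0 ia ia1 iaa gint1 gE gRe} => x y /=; rewrite subr0; ring.
have [iaa1 iaa2] := iaa; have [ia11 ia12] := ia1.
congr (_ +i* _); apply/esym/eqP; rewrite -subr_eq0 -RintegralB//; apply/eqP.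
  rewrite (@eq_Rintegral _ _ _ leb pos (g (complex.Re a) (complex.Im a) 0)); last first.
    by move=> t /set_mem/posP t0 /=; exact: gRe.
  rewrite /Rintegral integral_g//.
  have := integrableB mpos iaa1 ia11; apply: eq_integrable => // t /set_mem/posP t0 /=.
  by rewrite -gRe.
rewrite (@eq_Rintegral _ _ _ leb pos (g (complex.Re a) (complex.Im a) (- (pi / 2)))); last first.
  by move=> t /set_mem/posP t0 /=; exact: gIm.
rewrite /Rintegral integral_g//.
have := integrableB mpos iaa2 ia12; apply: eq_integrable => // t /set_mem/posP t0 /=.
by rewrite -gIm.
Qed.

End gamma.

(** * Gamma has no zero in the right half-plane *)

Section gamma_neq0.
Context {R : realType}.
Local Notation leb := (@lebesgue_measure R).
Local Notation pos := (`]0%R, +oo[%classic : set R).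
Implicit Types x y t u : R.

Lemma sin_le_id t : 0 <= t -> `|sin t| <= t.
Proof.
rewrite le_eqVlt => /predU1P[<-|t0]; first by rewrite sin0 normr0.
have [|c _] := @MVT R (@sin R) (@cos R) 0 t t0 (fun x _ => is_derive_sin x).
  by apply: continuous_subspaceT => x; exact: continuous_sin.
rewrite sin0 !subr0 => ->; rewrite normrM (gtr0_norm t0).
by rewrite ler_piMl ?cos_max// ltW.
Qed.

(** By the half-angle formula cos t = 1 - 2 sin^2 (t / 2), and |sin s| <= |s|. *)
Lemma cos_ge_sqr t : 1 - t ^+ 2 / 2 <= cos t.
Proof.
have tE : t = (t / 2) *+ 2 by rewrite mulr2n -splitr.
rewrite {2}tE cos_mulr2n cos2sin2.
have : sin (t / 2) ^+ 2 <= (t / 2) ^+ 2.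
  rewrite -real_normK ?num_real// -[leRHS]real_normK ?num_real//.
  rewrite ler_sqr ?nnegrE//; have [t0|t0] := leP 0 (t / 2).
    by rewrite (ger0_norm t0) sin_le_id.
  by rewrite -normrN -sinN (ltr0_norm t0) sin_le_id// oppr_ge0 ltW.
have -> : (t / 2) ^+ 2 = t ^+ 2 / 4 by field.
move: (sin _ ^+ 2) (t ^+ 2) => a b; lra.
Qed.

(** For u = e^(2 s) the right-hand side is 4 (e^s - e^(-s))^2, so |s| <= |e^s - e^(-s)| suffices. A
    bound linear in u and 1 / u is wanted because its integral against t^(x-1) e^(-t) only involves
    neighbouring Gamma values. *)
Lemma sqr_ln_le u : 0 < u -> ln u ^+ 2 <= 4 * (u - 2 + u^-1).
Proof.
move=> u0; pose s := ln u / 2.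
have uE : u = expR s ^+ 2 by rewrite -expRM_natr /s divfK// lnK.
have lE : ln u = 2 * s by rewrite mulrC /s divfK.
have e0 := expR_gt0 s; have h1 := expR_ge1Dx s; have h2 := expR_ge1Dx (- s).
rewrite lE uE exprMn; have -> : (expR s ^+ 2 - 2 + (expR s ^+ 2)^-1) = (expR s - expR (- s)) ^+ 2.
  by rewrite expRN; field; exact: lt0r_neq0.
suff : s ^+ 2 <= (expR s - expR (- s)) ^+ 2 by rewrite -natrX; lra.
rewrite -real_normK ?num_real// -[leRHS]real_normK ?num_real// ler_sqr ?nnegrE//.
have [s0|/ltW s0] := leP 0 s.
  have : expR (- s) <= 1 by rewrite -expR0 ler_expR oppr_le0.
  by move=> ?; rewrite (ger0_norm s0) (le_trans _ (ler_norm _))//; lra.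
have : expR s <= 1 by rewrite -expR0 ler_expR.
by move=> ?; rewrite (ler0_norm s0) distrC (le_trans _ (ler_norm _))//; lra.
Qed.

Definition rgamma x := \int[leb]_(t in pos) (expR ((x - 1) * ln t) * expR (- t)).

Lemma cGamma_real x : cGamma (x%:C) = (rgamma x)%:C.
Proof.
have E t : gamma_int x%:C t = (expR ((x - 1) * ln t) * expR (- t))%:C.
  by rewrite /gamma_int -(rmorphB (real_complex R)) cpow_realr -rmorphM.
rewrite cGammaE /cintegral; congr (_ +i* _).
  by apply: eq_Rintegral => t _; rewrite E.
under eq_Rintegral do rewrite E /=.
by rewrite Rintegral_cst// mul0r.
Qed.

Lemma rgamma_gt0 x : 0 < x -> 0 < rgamma x.
Proof.
move=> x0.
have ig := integrable_gamma x0.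
have I12 : `[1%R, 2%R]%classic `<=` pos.
  by move=> t /=; rewrite !in_itv/= andbT => /andP[+ _]; apply: lt_le_trans.
have /integrableP[mg _] := ig.
rewrite -lte_fin /rgamma /Rintegral fineK; last exact: integrable_fin_num.
(* A lower bound of the integrand on [1, 2], where 0 <= ln t <= 1 and t <= 2. *)
pose c := expR (- (`|x - 1| + 2)).
apply: (@lt_le_trans _ _ (\int[leb]_(t in `[1%R, 2%R]) c%:E)%E).
  rewrite integral_cst//= lebesgue_measure_itv/= lte_fin ltr1n -EFinB -EFinM lte_fin.
  by rewrite mulr_gt0 ?expR_gt0//; lra.
apply: (@le_trans _ _ (\int[leb]_(t in `[1%R, 2%R]) (expR ((x - 1) * ln t) * expR (- t))%:E)%E).
  apply: ge0_le_integral => //.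
  - by move=> t _; rewrite lee_fin expR_ge0.
  - by apply: measurable_funS mg.
  move=> t /=; rewrite in_itv/= => /andP[t1 t2].
  rewrite lee_fin -expRD ler_expR.
  have l0 : 0 <= ln t by exact: ln_ge0.
  have l1 : ln t <= 1.
    have := @le_ln1Dx R (t - 1); rewrite (addrC 1) subrK => h.
    by rewrite (le_trans (h _)); lra.
  have : - (`|x - 1|) <= (x - 1) * ln t.
    rewrite lerNl (le_trans (ler_norm _))// normrN normrM (ger0_norm l0).
    by rewrite ler_piMr.
  by lra.
apply: ge0_subset_integral => //.
Qed.

Lemma rgammaS x : 0 < x -> rgamma (x + 1) = x * rgamma x.
Proof.
move=> x0; apply: (@complexI R); rewrite rmorphM /= -!cGamma_real rmorphD /=.
by rewrite cGammaS.
Qed.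

(* If Gamma (x + i y) = 0 then \int w(t) cos (y ln (t / x)) dt = 0 for
   w(t) = t ^ (x - 1) e^(-t), which concentrates near t = x; bounding the cosine
   below by 1 - 2 y^2 (t / x - 2 + x / t) contradicts this by means of the
   moments Gamma (x + 1) and Gamma (x - 1). *)
Lemma cGamma_neq0_right x y : 1 < x -> 2 * y ^+ 2 < x - 1 -> cGamma (x +i* y) != 0.
Proof.
move=> x1 yx; have x0 : 0 < x by exact: lt_trans x1.
have xB0 : 0 < x - 1 by rewrite subr_gt0.
have xS0 : 0 < x + 1 by rewrite addr_gt0.
pose w t := expR ((x - 1) * ln t) * expR (- t).
have [i1 i2] := @cintegrable_gamma R (x +i* y) x0.
have mpos : measurable (pos : set (measurableTypeR R)) by [].
have iw := integrable_gamma x0.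
have iwB := integrable_gamma xB0.
have iwS := integrable_gamma xS0.
have wS t : 0 < t -> expR ((x + 1 - 1) * ln t) * expR (- t) = t * w t.
  move=> t0; have -> : (x + 1 - 1) * ln t = (x - 1) * ln t + ln t by ring.
  by rewrite expRD lnK// /w; ring.
have wB t : 0 < t -> expR ((x - 1 - 1) * ln t) * expR (- t) = t^-1 * w t.
  by move=> t0; rewrite expR_lnB1// /w; ring.
pose c := y * ln x.
have reE t : complex.Re (gamma_int (x +i* y) t) = w t * cos (y * ln t).
  by rewrite /gamma_int mulrC complex_ReZ Re_cpow /= subr0 /w; ring.
have imE t : complex.Im (gamma_int (x +i* y) t) = w t * sin (y * ln t).
  by rewrite /gamma_int mulrC complex_ImZ Im_cpow /= subr0 /w; ring.
apply/negP => /eqP; rewrite cGammaE => -[re0 im0].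
have : \int[leb]_(t in pos) ((cos c * complex.Re (gamma_int (x +i* y) t)) +
    (sin c * complex.Im (gamma_int (x +i* y) t))) = 0.
  rewrite RintegralD//; last 2 first.
  - exact: (integrableZl mpos (cos c) i1).
  - exact: (integrableZl mpos (sin c) i2).
  by rewrite !RintegralZl// re0 im0 !mulr0 addr0.
(* The factor 4 of [sqr_ln_le] times the 1/2 of [cos_ge_sqr], times y^2. *)
pose K := 2 * y ^+ 2.
have iK : leb.-integrable pos (fun t => ((1 + 2 * K) * w t - (K / x * (expR ((x + 1 - 1) * ln t) * expR (- t))
    + K * x * (expR ((x - 1 - 1) * ln t) * expR (- t))))%:E).
  have := integrableB mpos (integrableZl mpos (1 + 2 * K) iw)
    (integrableD mpos (integrableZl mpos (K / x) iwS) (integrableZl mpos (K * x) iwB)).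
  by apply: eq_integrable.
move=> I0.
have : \int[leb]_(t in pos) ((1 + 2 * K) * w t - (K / x * (expR ((x + 1 - 1) * ln t) * expR (- t))
    + K * x * (expR ((x - 1 - 1) * ln t) * expR (- t)))) <= 0.
  rewrite -[leRHS]I0; apply: le_Rintegral => //.
    have := integrableD mpos (integrableZl mpos (cos c) i1) (integrableZl mpos (sin c) i2).
    by apply: eq_integrable.
  move=> t /posP t0; rewrite wS// wB// reE imE.
  have -> : cos c * (w t * cos (y * ln t)) + sin c * (w t * sin (y * ln t)) =
     w t * cos (y * ln t - c) by rewrite cosB; ring.
  have -> : y * ln t - c = y * ln (t / x) by rewrite ln_div ?posrE// /c; ring.
  have -> : (1 + 2 * K) * w t - (K / x * (t * w t) + K * x * (t^-1 * w t)) =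
     w t * (1 - K * (t / x - 2 + (t / x)^-1)) by rewrite invf_div; ring.
  rewrite ler_wpM2l ?mulr_ge0 ?expR_ge0//.
  apply: le_trans (cos_ge_sqr _); rewrite lerB// exprMn.
  have := @sqr_ln_le (t / x) (divr_gt0 t0 x0).
  move=> /(ler_wpM2l (sqr_ge0 y)); rewrite /K; lra.
rewrite RintegralB//; last 2 first.
- exact: (integrableZl mpos _ iw).
- have := integrableD mpos (integrableZl mpos (K / x) iwS) (integrableZl mpos (K * x) iwB).
  by apply: eq_integrable.
rewrite RintegralD//; last 2 first.
- exact: (integrableZl mpos _ iwS).
- exact: (integrableZl mpos _ iwB).
rewrite !RintegralZl//.
have gB := rgammaS xB0; have gS := rgammaS x0.
rewrite -/(rgamma x) -/(rgamma (x + 1)) -/(rgamma (x - 1)).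
rewrite subrK in gB; rewrite gS.
have g0 := rgamma_gt0 xB0.
rewrite leNgt => /negP; apply.
rewrite gB.
(* All three moments are multiples of Gamma (x - 1), and the total coefficient is x - 1 - K: the
   hypothesis on [y] says that it is positive. *)
have -> : (1 + 2 * K) * ((x - 1) * rgamma (x - 1)) - (K / x * (x * ((x - 1) * rgamma (x - 1))) + K * x * rgamma (x - 1))
  = (x - 1 - K) * rgamma (x - 1) by field; exact: lt0r_neq0.
by rewrite mulr_gt0// subr_gt0.
Qed.

Lemma complexDnat (a : R[i]) n :
  a + n%:R = (complex.Re a + n%:R) +i* complex.Im a.
Proof. by case: a => x y; rewrite -(rmorph_nat (real_complex R)); simpc. Qed.

(** By Gamma (a + 1) = a Gamma (a), a zero at a would propagate to every a + n; the imaginary part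
    stays fixed while the real part grows into the region of [cGamma_neq0_right]. *)
Lemma cGamma_neq0 (a : R[i]) : 0 < complex.Re a -> cGamma a != 0.
Proof.
move=> a0; apply/negP => /eqP Ga0.
have GN n : cGamma (a + n%:R) = 0.
  elim: n => [|n IHn]; first by rewrite addr0.
  rewrite -addn1 natrD addrA cGammaS ?IHn ?mulr0//.
  by rewrite complexDnat /= ltr_wpDr.
pose n := (Num.truncn (2 * complex.Im a ^+ 2 + 1)).+1.
have nP : 2 * complex.Im a ^+ 2 + 1 < n%:R by exact: truncnS_gt.
have y0 := sqr_ge0 (complex.Im a).
have := GN n; rewrite complexDnat; apply/eqP; apply: cGamma_neq0_right; lra.
Qed.

End gamma_neq0.

(** * The Beta integral *)

Section beta.
Context {R : realType}.
Local Notation leb := (@lebesgue_measure R).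
Local Notation pos := (`]0%R, +oo[%classic : set R).
Implicit Types x y t u : R.
Local Open Scope ereal_scope.

Let mpos : measurable (pos : set (measurableTypeR R)).
Proof. by []. Qed.

Lemma measurable_posX : measurable (pos `*` pos : set (planeC R)).
Proof. exact: measurableX. Qed.

(** The trivial weight, named so that unweighted integrals fit the shape of [product_formula]. *)
Definition one d (T : measurableType d) : T -> R := cst 1%R.

Lemma product_formula_prod : product_formula (leb \x leb) leb leb (pos `*` pos)
  pos pos (one (T := planeC R))
  (one (T := measurableTypeR R)) (one (T := measurableTypeR R)) fst id snd id.
Proof.
move=> f g mf mg f0 g0.
have mF : measurable_fun setT (fun z : planeC R =>
    (f z.1 * g z.2)%:E).
  by apply/measurable_EFinP; apply: measurable_funM; exact: measurableT_comp.
rewrite /one; under eq_integral do rewrite mul1r.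
rewrite (@fubini_tonelli_set1 _ _ _ _ _ leb leb pos pos mpos mpos _ (measurable_funTS mF)); last first.
  by move=> x y _ _; rewrite lee_fin mulr_ge0.
under [in RHS]eq_integral do rewrite mul1r.
under [X in _ = _ * X]eq_integral do rewrite mul1r.
rewrite -ge0_integralZr//; last 3 first.
- exact/measurable_EFinP/measurable_funTS.
- by move=> x _; rewrite lee_fin.
- by apply: integral_ge0 => x _; rewrite lee_fin.
apply: eq_integral => x _; rewrite -ge0_integralZl//.
- exact/measurable_EFinP/measurable_funTS.
- by move=> y _; rewrite lee_fin.
- by rewrite lee_fin.
Qed.

(** The change of variables u = s / t, v = s + t, with Jacobian v / (1 + u)^2, split into two
    scalings: s = t u at fixed t, then v = (1 + u) t at fixed u, with Tonelli in between. *)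
Lemma product_formula_beta : product_formula (leb \x leb) leb leb (pos `*` pos)
  pos pos (one (T := planeC R))
  (fun u => (1 + u)^-1 ^+ 2)%R id (fun z => z.1 / z.2)%R id (fun z => z.1 + z.2)%R id.
Proof.
move=> f g mf mg f0 g0.
pose F (z : planeC R) := (f (z.1 / z.2) * g (z.1 + z.2))%:E.
pose G (z : planeC R) := (f z.1 * (z.2 * g (z.2 * (1 + z.1))))%:E.
have mF : measurable_fun setT F.
  apply/measurable_EFinP; apply: measurable_funM; apply: measurableT_comp => //.
    by apply: measurable_funM => //; exact: measurable_funV.
  exact: measurable_funD.
have mG : measurable_fun setT G.
  apply/measurable_EFinP; apply: measurable_funM; first exact: measurableT_comp.
  apply: measurable_funM => //; apply: measurableT_comp => //.
  by apply: measurable_funM => //; exact: measurable_funD.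
have F0 z : 0 <= F z by rewrite lee_fin mulr_ge0.
have G0 u t : pos u -> pos t -> 0 <= G (u, t).
  by move=> _ /posP/ltW t0; rewrite lee_fin !mulr_ge0.
rewrite /one; under eq_integral do rewrite mul1r.
rewrite (@fubini_tonelli_set2 _ _ _ _ _ leb leb pos pos mpos mpos F (measurable_funTS mF))//.
transitivity (\int[leb]_(t in pos) \int[leb]_(u in pos) G (u, t)).
  apply: eq_integral => t /set_mem/posP t0.
  rewrite [LHS](ge0_integral_scale_pos t0)//; last first.
    by apply: measurable_funTS; exact: (measurable_fun_pair1 t mF).
  apply: eq_integral => u _; rewrite /F /G/= -EFinM; congr EFin.
  by rewrite mulrAC divff ?mul1r ?gt_eqF// mulrDr mulr1 (addrC t); ring.
rewrite -(@fubini_tonelli_set _ _ _ _ _ leb leb pos pos mpos mpos G (measurable_funTS mG))//.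
rewrite -ge0_integralZr//; last 3 first.
- apply/measurable_EFinP/measurable_funTS; apply: measurable_funM => //.
  by apply: measurable_funX; apply: measurable_funV; exact: measurable_funD.
- by move=> u /posP u0; rewrite lee_fin mulr_ge0// exprn_ge0// invr_ge0 addr_ge0// ltW.
- by apply: integral_ge0 => v /posP/ltW v0; rewrite lee_fin mulr_ge0.
apply: eq_integral => u /set_mem/posP u0.
have u1 : (0 < 1 + u)%R by rewrite addr_gt0.
rewrite -ge0_integralZl//; last 3 first.
- by apply/measurable_EFinP/measurable_funTS; exact: measurable_funM.
- by move=> v /posP/ltW v0; rewrite lee_fin mulr_ge0.
- by rewrite lee_fin mulr_ge0// exprn_ge0// invr_ge0 ltW.
rewrite [RHS](ge0_integral_scale_pos u1)//; last 2 first.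
- apply: measurable_funTS; apply: measurable_funeM; apply/measurable_EFinP.
  exact: measurable_funM.
- move=> v v0; rewrite -EFinM lee_fin !mulr_ge0 ?exprn_ge0 ?invr_ge0//; exact: ltW.
apply: eq_integral => t _; rewrite /G/= -!EFinM; congr EFin.
rewrite (mulrC t (1 + u)%R) expr2; move: (g _) (f _) => gg ff; field; exact: lt0r_neq0.
Qed.

End beta.

Section cGammaM.
Context {R : realType}.
Local Notation leb := (@lebesgue_measure R).
Local Notation pos := (`]0%R, +oo[%classic : set R).
Implicit Types x y t u : R.

Let mpos : measurable (pos : set (measurableTypeR R)).
Proof. by []. Qed.

(** The phases add, so both parts of the product are its modulus times a cosine or a sine. Bounding
    the terms of the product separately would cost a factor 2. *)
Lemma cpowM_le x y (a b : R[i]) :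
  `|complex.Re (cpow x a * cpow y b)| <=
    expR (complex.Re a * ln x) * expR (complex.Re b * ln y) /\
  `|complex.Im (cpow x a * cpow y b)| <=
    expR (complex.Re a * ln x) * expR (complex.Re b * ln y).
Proof.
rewrite complex_ReM complex_ImM !Re_cpow !Im_cpow.
set p := expR _; set q := expR _; set s := complex.Im a * _; set t := complex.Im b * _.
have pq : 0 <= p * q by rewrite mulr_ge0 ?expR_ge0.
have -> : p * cos s * (q * cos t) - p * sin s * (q * sin t) = p * q * cos (s + t).
  by rewrite cosD; ring.
have -> : p * cos s * (q * sin t) + p * sin s * (q * cos t) = p * q * sin (s + t).
  by rewrite sinD; ring.
by split; rewrite normrM (ger0_norm pq) ler_piMr ?cos_max ?sin_max.
Qed.

Lemma rgammaE x : (0 < x) ->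
  (\int[leb]_(t in pos) (expR ((x - 1) * ln t) * expR (- t))%:E = (rgamma x)%:E)%E.
Proof.
move=> x0; rewrite /rgamma /Rintegral fineK//.
exact: (integrable_fin_num mpos (integrable_gamma x0)).
Qed.

(** [bint1] and [bint2] are the factors of s^(a-1) e^(-s) t^(b-1) e^(-t) in u = s / t and v = s + t.
    The shifts by 2 cancel against the weights: (1 + u)^(-2) restores the Beta integrand, v the
    integrand of Gamma (a + b). *)
Let bint1 (a b : R[i]) u := (cpow u (a - 1) * cpow (1 + u) (2 - (a + b))).
Let bint2 (a b : R[i]) v := (cpow v (a + b - 2) * (expR (- v))%:C).

Let bint_eq a b s t : (0 < s) -> (0 < t) ->
  (bint1 a b (s / t) * bint2 a b (s + t) = gamma_int a s * gamma_int b t).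
Proof.
move=> s0 t0; have st : (0 < s / t) by rewrite divr_gt0.
have st1 : (0 < 1 + s / t) by rewrite addr_gt0.
rewrite /bint1 /bint2 /gamma_int.
have e1 c : cpow (s + t) c = cpow t c * cpow (1 + s / t) c.
  have -> : s + t = t * (1 + s / t) by field; exact: lt0r_neq0.
  exact: cpowM.
have e2 : cpow s (a - 1) = cpow (s / t) (a - 1) * cpow t (a - 1).
  by rewrite -[in LHS](divfK (lt0r_neq0 t0) s) cpowM.
have -> : expR (- (s + t)) = (expR (- s) * expR (- t)) by rewrite opprD expRD.
rewrite rmorphM /=.
rewrite e1 e2.
have -> : (a + b - 2 = (a - 1) + (b - 1)) by ring.
have -> : (2 - (a + b) = - ((a - 1) + (b - 1))) by ring.
rewrite (cpowD t); have := cpowNr (1 + s / t) (a - 1 + (b - 1)).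
set A := cpow (1 + s / t) (- _); set B := cpow (1 + s / t) _ => AB.
rewrite -[RHS]mulr1 -AB; ring.
Qed.

(** The two product formulas, equalities in [0, +oo], identify this integral times Gamma (x + y)
    with Gamma (x) Gamma (y). The latter is finite and Gamma (x + y) > 0, so the integral cannot be
    infinite. *)
Lemma integrable_beta x y : (0 < x) -> (0 < y) ->
  leb.-integrable pos (EFin \o (fun u => (1 + u)^-1 ^+ 2 *
    (expR ((x - 1) * ln u) * expR ((2 - (x + y)) * ln (1 + u))))).
Proof.
move=> x0 y0.
pose fr u := (expR ((x - 1) * ln u) * expR ((2 - (x + y)) * ln (1 + u))).
pose gr v := (expR ((x + y - 2) * ln v) * expR (- v)).
have mexp (c : R) : measurable_fun setT (fun u => expR (c * ln u)).
  apply: (measurableT_comp (@measurable_expR R)).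
  by apply: measurable_funM => //; exact: measurable_ln.
have mfr : measurable_fun setT fr.
  apply: measurable_funM => //.
  by apply: (measurableT_comp (mexp _)); exact: measurable_funD.
have mgr : measurable_fun setT gr.
  by apply: measurable_funM => //; exact: measurable_expRN.
have xy0 : (0 < x + y) by rewrite addr_gt0.
have w10 u : pos u -> (0 <= (1 + u)^-1 ^+ 2 * fr u).
  move=> /posP/ltW u0; apply: mulr_ge0; last by rewrite mulr_ge0 ?expR_ge0.
  by rewrite exprn_ge0// invr_ge0 addr_ge0.
apply/integrableP; split.
  apply/measurable_EFinP/measurable_funTS; apply: measurable_funM => //.
  by apply: measurable_funX; apply: measurable_funV; exact: measurable_funD.
under eq_integral => u /set_mem pu.
  rewrite /= (ger0_norm (w10 _ pu)) /=; over.
have fr0 u : 0 <= fr u by rewrite mulr_ge0 ?expR_ge0.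
have gr0 u : 0 <= gr u by rewrite mulr_ge0 ?expR_ge0.
pose W (c : R) t := expR ((c - 1) * ln t) * expR (- t).
have mW c : measurable_fun setT (W c).
  by apply: measurable_funM; [exact: mexp|exact: measurable_expRN].
have W0 c t : 0 <= W c t by rewrite mulr_ge0 ?expR_ge0.
have E := product_formula_beta mfr mgr fr0 gr0.
have := product_formula_prod (mW x) (mW y) (W0 x) (W0 y).
rewrite (_ : (\int[_]_(z in _) _)%E = (\int[leb \x leb]_(z in pos `*` pos)
    (@one R _ _ z * (fr (z.1 / z.2) * gr (z.1 + z.2)))%:E)%E); last first.
  apply: eq_integral => -[s t] /set_mem[/= /posP s0 /posP t0].
  congr (_%:E); congr (_ * _).
  (* The real factorisation is [bint_eq] at real exponents, read back through the embedding of the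
     reals. *)
  apply: (@complexI R); rewrite /W /fr /gr /= !rmorphM /=.
  have := @bint_eq x%:C y%:C s t s0 t0.
  rewrite /bint1 /bint2 /gamma_int -!(rmorphB (real_complex R)) -!(rmorphD (real_complex R)).
  rewrite -(rmorph_nat (real_complex R)) -!(rmorphB (real_complex R)) !cpow_realr.
  by move=> ->.
rewrite E /one; under [X in _ = (X * _)%E -> _]eq_integral do rewrite mul1r.
under [X in _ = (_ * X)%E -> _]eq_integral do rewrite mul1r.
rewrite !rgammaE//.
rewrite [X in (_ * X)%E = _ -> _](_ : _ = (rgamma (x + y))%:E); last first.
  rewrite -rgammaE//; apply: eq_integral => v /set_mem/posP v0; congr EFin.
  rewrite /gr -[X in X * _](lnK (x := v)) ?posrE// mulrA -expRD; congr (expR _ * _); ring.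
move=> Er; rewrite ltey; apply/eqP => Iy; move: Er; rewrite Iy.
by rewrite gt0_mulye ?lte_fin ?rgamma_gt0.
Qed.

(** One double integral over the quadrant, evaluated twice: it factors in the variables s, t and
    also in s / t, s + t. *)
Lemma cGammaM (a b : R[i]) : (0 < complex.Re a) -> (0 < complex.Re b) ->
  let f u := (cpow u (a - 1) * cpow (1 + u) (- (a + b))) in
  cintegrable leb pos f /\
  (cGamma a * cGamma b = cGamma (a + b) * cintegral leb pos f).
Proof.
move=> a0 b0 f.
have ReD2 (z z' : R[i]) : complex.Re (z + z') = (complex.Re z + complex.Re z').
  by case: z; case: z'.
have ReN (z : R[i]) : complex.Re (- z) = (- complex.Re z) by case: z.
have ab0 : (0 < complex.Re (a + b)) by rewrite ReD2 addr_gt0.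
have m1 : cmeasurable (bint1 a b).
  apply: cmeasurableM; first exact: cmeasurable_cpow.
  apply: (cmeasurable_comp (cmeasurable_cpow _)); exact: measurable_funD.
have m2 : cmeasurable (bint2 a b).
  apply: cmeasurableM; first exact: cmeasurable_cpow.
  by apply: cmeasurable_real; exact: measurable_expRN.
have mw : measurable_fun setT (fun u : R => (1 + u)^-1 ^+ 2).
  by apply: measurable_funX; apply: measurable_funV; exact: measurable_funD.
have i1 : cintegrable leb pos (fun u => ((1 + u)^-1 ^+ 2)%:C * bint1 a b u).
  apply: cintegrable_le (integrable_beta a0 b0) _ => //.
    by apply: cmeasurableM => //; exact: cmeasurable_real.
  suff key u : 0 <= u ->
      `|complex.Re (bint1 a b u)| <= expR ((complex.Re a - 1) * ln u) *
        expR ((2 - (complex.Re a + complex.Re b)) * ln (1 + u)) /\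
      `|complex.Im (bint1 a b u)| <= expR ((complex.Re a - 1) * ln u) *
        expR ((2 - (complex.Re a + complex.Re b)) * ln (1 + u)).
    move=> u /posP/ltW u0; have [h1 h2] := key u u0.
    rewrite complex_ReZ complex_ImZ (normrM _ (complex.Re _)) (normrM _ (complex.Im _)).
    rewrite (ger0_norm (exprn_ge0 _ _)).
      by split; rewrite ler_wpM2l// exprn_ge0// invr_ge0 addr_ge0.
    by rewrite invr_ge0 addr_ge0.
  move=> u0; rewrite /bint1.
  have [h1 h2] := cpowM_le u (1 + u) (a - 1) (2 - (a + b)).
  have ea : complex.Re (a - 1) = complex.Re a - 1 by rewrite ReD2 ReN.
  have eab : complex.Re (2 - (a + b)) = 2 - (complex.Re a + complex.Re b).
    by rewrite (ReD2 2) ReN (ReD2 a); congr (_ - _).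
  by rewrite ea eab in h1 h2.
have i2 : cintegrable leb pos (fun u => u%:C * bint2 a b u).
  apply: eq_cintegrable (cintegrable_gamma ab0) => //.
  move=> u /set_mem/posP u0; rewrite /gamma_int /bint2 mulrA; congr (_ * _).
  rewrite -[in RHS](cpow_1r u0) -cpowD; congr cpow; ring.
have e1 : {in pos, (fun u => ((1 + u)^-1 ^+ 2)%:C * bint1 a b u) =1 f}.
  move=> u /set_mem/posP u0.
  have u1 : (0 < 1 + u) by rewrite addr_gt0.
  have hw : ((1 + u)^-1 ^+ 2)%:C * ((1 + u) ^+ 2)%:C = 1 :> R[i].
    by rewrite -(rmorphM (real_complex R)) -exprMn mulVf ?gt_eqF// expr1n.
  rewrite /bint1 /f (cpowD _ 2) (cpow_natr 2)//.
  move: (cpow u _) (cpow _ (- _)) hw => A C hw.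
  by rewrite -[RHS]mul1r -hw; ring.
have E2 : cintegral leb pos (fun u => u%:C * bint2 a b u) = cGamma (a + b).
  apply: eq_cintegral => u /set_mem/posP u0.
  rewrite /gamma_int /bint2 mulrA; congr (_ * _).
  rewrite -[in LHS](cpow_1r u0) -cpowD; congr cpow; ring.
have one_ge0 d (T : measurableType d) (D : set T) w : D w -> 0 <= @one R _ _ w.
  by rewrite /one.
have mone d (T : measurableType d) : measurable_fun setT (@one R _ T) by [].
have oneE d (T : measurableType d) (mu : {measure set T -> \bar R}) (D : set T) (k : T -> R[i]) :
    cintegral mu D (fun w => (@one R _ _ w)%:C * k w) = cintegral mu D k.
  by apply: eq_cintegral => w _; rewrite mul1r.
have oneI d (T : measurableType d) (mu : {measure set T -> \bar R}) (D : set T) (k : T -> R[i]) :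
    measurable D -> cintegrable mu D k -> cintegrable mu D (fun w => (@one R _ _ w)%:C * k w).
  by move=> mD; apply: eq_cintegrable => // w _; rewrite mul1r.
have ga := oneI _ _ _ _ _ mpos (cintegrable_gamma a0).
have gb := oneI _ _ _ _ _ mpos (cintegrable_gamma b0).
split; first exact: eq_cintegrable i1.
have [_] := product_formula_cintegral (@measurable_posX R) mpos mpos (mone _ _) (mone _ _)
  (mone _ _) measurable_fst (@measurable_id _ _ _) measurable_snd (@measurable_id _ _ _)
  (@one_ge0 _ _ _) (@one_ge0 _ _ _) (@one_ge0 _ _ _) (@product_formula_prod R)
  (cmeasurable_gamma a) (cmeasurable_gamma b) ga gb.
rewrite !oneE => P1.
have w20 u : pos u -> 0 <= u by move=> /posP/ltW.
have w10 u : pos u -> 0 <= (1 + u)^-1 ^+ 2.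
  by move=> /posP/ltW u0; rewrite exprn_ge0// invr_ge0 addr_ge0.
have mdiv : measurable_fun setT (fun z : planeC R => z.1 / z.2).
  by apply: measurable_funM => //; exact: measurable_funV.
have madd : measurable_fun setT (fun z : planeC R => z.1 + z.2).
  exact: measurable_funD.
have [_] := product_formula_cintegral (@measurable_posX R) mpos mpos (mone _ _) mw
  (@measurable_id _ _ _) mdiv (@measurable_id _ _ _) madd (@measurable_id _ _ _)
  (@one_ge0 _ _ _) w10 w20 (@product_formula_beta R) m1 m2 i1 i2.
rewrite oneE E2 (eq_cintegral leb e1) mulrC => <-.
rewrite !cGammaE -P1; apply: eq_cintegral => -[s t] /set_mem[/posP s0 /posP t0] /=.
exact/esym/(bint_eq a b s0 t0).
Qed.

End cGammaM.

(** * Gaussian integrals of Hermitian forms *)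

Section lebesgueC.
Local Open Scope ereal_scope.
Context {R : realType}.
Local Notation leb := (@lebesgue_measure R).
Local Notation plane := (@lebesgue_plane R).

Lemma ge0_integral_plane_affine (c : R) (w : planeC R) (f : planeC R -> \bar R) :
  (0 < c)%R -> measurable_fun setT f -> (forall z, 0 <= f z) ->
  \int[plane]_z f z =
  (c ^+ 2)%:E * \int[plane]_z f (c * z.1 + w.1, c * z.2 + w.2)%R.
Proof.
move=> c0 mf f0.
have maff (b : R) : measurable_fun setT (fun x : measurableTypeR R => c * x + b : measurableTypeR R)%R.
  by apply: measurable_funD => //; exact: measurable_funM.
have mg : measurable_fun setT (fun z : planeC R => f (c * z.1 + w.1, c * z.2 + w.2)%R).
  apply: (measurableT_comp mf); apply: measurable_fun_pair.
    exact: (measurableT_comp (maff w.1)).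
  exact: (measurableT_comp (maff w.2)).
have m2 (x : R) : measurable_fun setT (fun y : measurableTypeR R => f (x, y)).
  exact: measurable_fun_pair2.
have mg2 (x : R) : measurable_fun setT (fun y : measurableTypeR R => f (x, c * y + w.2)%R).
  exact: (measurableT_comp (m2 x) (maff w.2)).
rewrite /lebesgue_plane fubini_tonelli1// [in RHS]fubini_tonelli1//.
rewrite (ge0_integral_affine w.1 c0)//; last 2 first.
- exact: measurable_fun_fubini_tonelli_F.
- by move=> x _; exact: integral_ge0.
rewrite preimage_setT expr2 EFinM -muleA; congr (_ * _).
rewrite -ge0_integralZl//; last 3 first.
- exact: (measurable_fun_fubini_tonelli_F (m2 := leb) _ mg).
- by move=> x _; exact: integral_ge0.
- by rewrite lee_fin ltW.
apply: eq_integral => x _; rewrite /fubini_F.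
rewrite [LHS](ge0_integral_affine w.2 c0)//; exact: m2.
Qed.

Lemma ge0_integral_lebesgueCS N (f : N.+1.-tuple (planeC R) -> \bar R) :
  measurable_fun setT f -> (forall x, 0 <= f x) ->
  \int[lebesgueC N.+1]_x f x = \int[lebesgueC N]_t \int[plane]_z f (tcons (z, t)).
Proof.
move=> mf f0.
transitivity (\int[pushforward (plane \x lebesgueC N) (@tcons _ _ N)]_x f x).
  by [].
rewrite ge0_integral_pushforward//; last exact: measurable_tcons.
rewrite preimage_setT (fubini_tonelli2 (f \o @tcons _ _ N))//.
  exact: (measurableT_comp mf (@measurable_tcons _ _ N)).
by move=> x; exact: f0.
Qed.

(** A separate real factor for each complex coordinate, so that some blocks can be dilated while the
    others stay fixed. *)
Definition scale_tuple N (c : 'I_N -> R) (x : N.-tuple (planeC R)) :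
    N.-tuple (planeC R) :=
  [tuple (c i * (tnth x i).1, c i * (tnth x i).2)%R | i < N].

Lemma tnth_scale_tuple N (c : 'I_N -> R) x i :
  tnth (scale_tuple c x) i = (c i * (tnth x i).1, c i * (tnth x i).2)%R.
Proof. by rewrite tnth_mktuple. Qed.

Lemma measurable_scale_tuple N (c : 'I_N -> R) : measurable_fun setT (scale_tuple c).
Proof.
apply/measurable_fun_tnthP => i.
rewrite (_ : _ \o _ = fun x => (c i * (tnth x i).1, c i * (tnth x i).2)%R); last first.
  by apply/funext => x /=; rewrite tnth_scale_tuple.
have mt := @measurable_tnth _ (planeC R) N i.
apply: measurable_fun_pair; apply: measurable_funM => //.
  exact: (measurableT_comp measurable_fst mt).
exact: (measurableT_comp measurable_snd mt).
Qed.

Lemma scale_tuple_tcons N (c : 'I_N.+1 -> R) z (t : N.-tuple (planeC R)) :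
  scale_tuple c (tcons (z, t)) =
  tcons ((c ord0 * z.1, c ord0 * z.2)%R, scale_tuple (fun i => c (lift ord0 i)) t).
Proof.
apply: eq_from_tnth => i; rewrite tnth_scale_tuple /tcons.
have [->|] := eqVneq i ord0; first by rewrite !tnth0.
rewrite eq_sym => /unlift_some[j -> _].
by rewrite !tnthS tnth_scale_tuple.
Qed.

Lemma ge0_integral_scale_tuple N (c : 'I_N -> R) (f : N.-tuple (planeC R) -> \bar R) :
  (forall i, 0 < c i)%R -> measurable_fun setT f -> (forall x, 0 <= f x) ->
  \int[lebesgueC N]_x f x =
  (\prod_i c i ^+ 2)%:E * \int[lebesgueC N]_x f (scale_tuple c x).
Proof.
elim: N c f => [|N IHN] c f c0 mf f0.
  rewrite big_ord0 mul1e; apply: eq_integral => x _; congr f.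
  by apply: eq_from_tnth => -[].
pose c' i := c (lift ord0 i).
have mfc : measurable_fun setT (f \o scale_tuple c).
  exact: (measurableT_comp mf (@measurable_scale_tuple _ c)).
have mft : measurable_fun setT (f \o @tcons _ _ N).
  exact: (measurableT_comp mf (@measurable_tcons _ _ N)).
have mfct : measurable_fun setT (f \o scale_tuple c \o @tcons _ _ N).
  exact: (measurableT_comp mfc (@measurable_tcons _ _ N)).
pose G t : \bar R := \int[plane]_z f (tcons (z, t)).
pose Gc t : \bar R := \int[plane]_z f (scale_tuple c (tcons (z, t))).
have mG : measurable_fun setT G.
  exact: (measurable_fun_fubini_tonelli_G (m1 := plane) _ mft (fun x => f0 _)).
have mGc : measurable_fun setT Gc.
  exact: (measurable_fun_fubini_tonelli_G (m1 := plane) _ mfct (fun x => f0 _)).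
have G0 t : 0 <= G t by exact: integral_ge0.
have Gc0 t : 0 <= Gc t by exact: integral_ge0.
rewrite (ge0_integral_lebesgueCS mf f0).
rewrite (@ge0_integral_lebesgueCS N (fun x => f (scale_tuple c x)) mfc)//.
rewrite -/(G _) (IHN c' G (fun i => c0 _) mG G0) big_ord_recl mulrC EFinM -muleA.
congr (_ * _); rewrite -(ge0_integralZl _ measurableT mGc)//; last first.
  by rewrite lee_fin sqr_ge0.
apply: eq_integral => t _; rewrite /G.
rewrite (ge0_integral_plane_affine (0, 0)%R (c0 ord0))//; last first.
  exact: (measurable_fun_pair1 _ mft).
congr (_ * _); apply: eq_integral => z _.
by rewrite scale_tuple_tcons/= !addr0.
Qed.

End lebesgueC.

(** * Hermitian forms and Schur complements *)

Section hermitian.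
Context {R : realType}.
Local Notation C := R[i].

Lemma conj_complex (x y : R) : Num.conj (x +i* y : C) = x -i* y.
Proof. by []. Qed.

Definition herm n (B : 'M[C]_n) (X : 'cV[C]_n) : C := (X ^t* *m B *m X) 0 0.

Lemma adj_mx_mul m n p (A : 'M[C]_(m, n)) (B : 'M[C]_(n, p)) :
  (A *m B) ^t* = B ^t* *m A ^t*.
Proof. by rewrite trmx_mul map_mxM. Qed.

Lemma adj_mxD m n (A B : 'M[C]_(m, n)) : (A + B) ^t* = A ^t* + B ^t*.
Proof. by apply/matrixP => i j; rewrite !mxE rmorphD. Qed.

Lemma adj_mxZ m n (a : C) (A : 'M[C]_(m, n)) : (a *: A) ^t* = Num.conj a *: A ^t*.
Proof. by apply/matrixP => i j; rewrite !mxE rmorphM. Qed.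

Lemma posdef_adj n (B : 'M[C]_n) : posdefmx B -> B ^t* = B.
Proof. by move=> [/is_hermitianmxP + _]; rewrite expr0 scale1r => {2}->. Qed.

Lemma posdef_gt0 n (B : 'M[C]_n) X : posdefmx B -> X != 0 -> 0 < herm B X.
Proof. by move=> [_]; apply. Qed.

Lemma posdefP n (B : 'M[C]_n) : B ^t* = B ->
  (forall X, X != 0 -> 0 < herm B X) -> posdefmx B.
Proof.
move=> BE B0; split => //; apply/is_hermitianmxP.
by rewrite expr0 scale1r BE.
Qed.

Lemma herm0 n (B : 'M[C]_n) : herm B 0 = 0.
Proof. by rewrite /herm mulmx0 mxE. Qed.

Lemma qform_gt0 n (B : 'M[C]_n) X : posdefmx B -> X != 0 -> 0 < qform B X.
Proof. by move=> pB X0; have := posdef_gt0 pB X0; rewrite ltcE => /andP[]. Qed.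

Lemma qform_ge0 n (B : 'M[C]_n) X : posdefmx B -> 0 <= qform B X.
Proof.
move=> pB; have [->|X0] := eqVneq X 0; last by rewrite ltW// qform_gt0.
by rewrite /qform -/(herm B 0) herm0.
Qed.

Lemma hermE n (B : 'M[C]_n) X : posdefmx B -> herm B X = (qform B X)%:C.
Proof.
move=> pB; have [->|X0] := eqVneq X 0.
  by rewrite /qform -/(herm B 0) herm0.
have := posdef_gt0 pB X0; rewrite /qform -/(herm B X).
by case: (herm B X) => x y; rewrite ltcE /= => /andP[/eqP -> _].
Qed.

Section schur.
Variables (N : nat) (B : 'M[C]_(1 + N)).
Hypothesis pB : posdefmx B.

Let a := ulsubmx B 0 0.
Let u := ursubmx B.
Let v := dlsubmx B.

Definition schur := drsubmx B - a^-1 *: (v *m u).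

Let BE : B = block_mx a%:M u v (drsubmx B).
Proof. by rewrite /a -mx11_scalar submxK. Qed.

Let BtE : block_mx ((ulsubmx B) ^t*) (v ^t*) (u ^t*) ((drsubmx B) ^t*) = B.
Proof.
rewrite -[RHS](posdef_adj pB) -[in RHS](submxK B) tr_block_mx map_block_mx.
by [].
Qed.

Let vt : v ^t* = u.
Proof. by have := congr1 ursubmx BtE; rewrite block_mxKur. Qed.

Let ut : u ^t* = v.
Proof. by have := congr1 dlsubmx BtE; rewrite block_mxKdl. Qed.

Let dt : (drsubmx B) ^t* = drsubmx B.
Proof. by have := congr1 drsubmx BtE; rewrite block_mxKdr. Qed.

Lemma posdef_corner_gt0 : 0 < a.
Proof.
have := posdef_gt0 pB (X := col_mx 1%:M 0).
have -> : herm B (col_mx 1%:M 0) = a.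
  rewrite /herm BE tr_col_mx map_row_mx mul_row_block mul_row_col.
  rewrite !trmx0 !map_mx0 !mul0mx !mulmx0 !addr0 trmx1 map_mx1 !mul1mx mulmx1.
  by rewrite mxE eqxx mulr1n.
apply; apply/negP => /eqP/matrixP/(_ 0 0).
by rewrite mxE; case: splitP => // j _; rewrite !mxE ord1 eqxx => /eqP; rewrite oner_eq0.
Qed.

Let a_neq0 : a != 0. Proof. exact: lt0r_neq0 posdef_corner_gt0. Qed.

Let aJ : Num.conj a = a.
Proof. by apply: CrealP; exact: gtr0_real posdef_corner_gt0. Qed.

Let aVJ : Num.conj a^-1 = a^-1. Proof. by rewrite -[in RHS]aJ; apply: fmorphV. Qed.

(** Completing the square in the first coordinate. *)
Lemma herm_schur (Z : 'cV[C]_1) (Y : 'cV[C]_N) :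
  herm B (col_mx Z Y) =
  a * ((Z 0 0 + a^-1 * (u *m Y) 0 0) * Num.conj (Z 0 0 + a^-1 * (u *m Y) 0 0)) +
  herm schur Y.
Proof.
pose W := Z + a^-1 *: (u *m Y).
have -> : Z 0 0 + a^-1 * (u *m Y) 0 0 = W 0 0 by rewrite !mxE.
have -> : W 0 0 * Num.conj (W 0 0) = (W ^t* *m W) 0 0.
  by rewrite [RHS]mxE big_ord1 !mxE mulrC.
rewrite /herm; set P := (_ *m B *m _); set Q := (Y ^t* *m _ *m Y).
have -> : a * (W ^t* *m W) 0 0 + Q 0 0 = (a *: (W ^t* *m W) + Q) 0 0 by rewrite !mxE.
congr (fun_of_matrix _ 0 0).
rewrite /P {P} BE tr_col_mx map_row_mx mul_row_block mul_row_col.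
rewrite /W adj_mxD adj_mxZ aVJ adj_mx_mul ut.
rewrite /Q /schur mul_mx_scalar.
set Zt := Z ^t*; set Yt := Y ^t*; set D := drsubmx B.
rewrite mulmxBr mulmxBl !(mulmxDl, mulmxDr) !(=^~ scalemxAl, =^~ scalemxAr).
rewrite !scalerDr !scalerA !mulfV// !scale1r !mulmxA.
rewrite div1r -!addrA; congr (_ + _).
rewrite [LHS]addrCA; congr (_ + _); congr (_ + _).
by rewrite [RHS]addrC subrK.
Qed.

Lemma posdef_schur : posdefmx schur.
Proof.
apply: posdefP.
  rewrite /schur adj_mxD dt; congr (_ + _).
  by rewrite -scaleNr adj_mxZ adj_mx_mul vt ut rmorphN /= aVJ scaleNr.
(* This first coordinate annihilates the square, so the Schur form at [Y] is a value of the form of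
   [B] at a nonzero vector. *)
move=> Y Y0; pose Z := - (a^-1 *: (u *m Y)).
have := herm_schur Z Y; rewrite {1}/Z !mxE addNr mul0r mulr0 add0r => <-.
apply: posdef_gt0 => //; apply: contra Y0 => /eqP/(congr1 dsubmx).
by rewrite col_mxKd => ->; rewrite linear0.
Qed.

(** Block elimination: [B] is a unit lower triangular block matrix times an upper triangular one
    with diagonal [a], [schur]. *)
Lemma det_schur : \det B = a * \det schur.
Proof.
have -> : B = block_mx 1%:M 0 (a^-1 *: v) 1%:M *m block_mx a%:M u 0 schur.
  rewrite mulmx_block !mul1mx !mul0mx !addr0 -scalemxAl mul_mx_scalar.
  rewrite scalerA mulVf// scale1r -scalemxAl /schur addrC subrK.
  exact: BE.
by rewrite det_mulmx det_lblock det_ublock !det1 !mul1r det_scalar1.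
Qed.

Lemma qform_schur (Z : 'cV[C]_1) (Y : 'cV[C]_N) :
  let w := Z 0 0 + a^-1 * (u *m Y) 0 0 in
  qform B (col_mx Z Y) =
  complex.Re a * (complex.Re w ^+ 2 + complex.Im w ^+ 2) + qform schur Y.
Proof.
move=> w; rewrite {1}/qform -/(herm B _) herm_schur -/w hermE; last exact: posdef_schur.
have -> : a = (complex.Re a)%:C.
  by move: posdef_corner_gt0; case: (a) => x y; rewrite ltcE /= => /andP[/eqP -> _].
by case: w => x y; rewrite conj_complex; simpc => /=; ring.
Qed.

End schur.
End hermitian.

Section gauss.
Local Open Scope ereal_scope.
Context {R : realType}.
Local Notation leb := (@lebesgue_measure R).
Local Notation plane := (@lebesgue_plane R).

(** The shift [w] is there for the term that completing the square adds to the first coordinate; an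
    affine substitution absorbs it together with the factor [b]. *)
Lemma integral_gauss_plane (b : R) (w : planeC R) : (0 < b)%R ->
  \int[plane]_z (expR (- (b * ((z.1 + w.1) ^+ 2 + (z.2 + w.2) ^+ 2))))%:E = (pi / b)%:E.
Proof.
move=> b0.
pose g (z : planeC R) := (gauss_fun z.1 * gauss_fun z.2)%R%:E.
have mg : measurable_fun setT g.
  apply/measurable_EFinP; apply: measurable_funM.
    exact: (measurableT_comp (@measurable_gauss_fun R) measurable_fst).
  exact: (measurableT_comp (@measurable_gauss_fun R) measurable_snd).
have g0 z : 0 <= g z by rewrite lee_fin mulr_ge0// gauss_fun_ge0.
have mge : measurable_fun setT (fun x : measurableTypeR R => (gauss_fun x)%:E).
  by apply/measurable_EFinP; exact: (@measurable_gauss_fun R).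
have ge0 x : 0 <= (gauss_fun (x : R))%:E by rewrite lee_fin gauss_fun_ge0.
have Ig : \int[plane]_z g z = pi%:E.
  rewrite /lebesgue_plane fubini_tonelli1//.
  transitivity (\int[leb]_x ((gauss_fun x)%:E * (Num.sqrt pi)%:E)).
    apply: eq_integral => x _; rewrite /fubini_F /g.
    under eq_integral do rewrite /= EFinM.
    by rewrite (ge0_integralZl _ measurableT mge)// integralT_gauss.
  by rewrite (ge0_integralZr _ measurableT mge)// integralT_gauss -EFinM -expr2 sqr_sqrtr ?pi_ge0.
have sb0 : (0 < Num.sqrt b)%R by rewrite sqrtr_gt0.
have := ge0_integral_plane_affine (Num.sqrt b * w.1, Num.sqrt b * w.2)%R sb0 mg g0.
rewrite Ig sqr_sqrtr ?(ltW b0)// => H.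
have -> : (pi / b)%:E = (b^-1)%:E * pi%:E :> \bar R by rewrite -EFinM mulrC.
rewrite H muleA -EFinM mulVf ?gt_eqF// mul1e; apply: eq_integral => z _.
rewrite /g /gauss_fun/= -expRD -!mulrDr !exprMn sqr_sqrtr ?(ltW b0)//.
by congr (expR _)%:E; ring.
Qed.

Lemma col_of_tuple_tcons N (z : planeC R) (t : N.-tuple (planeC R)) :
  col_of_tuple (tcons (z, t)) =
  col_mx (const_mx ((z.1 : R) +i* (z.2 : R))) (col_of_tuple t) :> 'cV[R[i]]_(1 + N).
Proof.
apply/matrixP => i j; rewrite [LHS]mxE [RHS]mxE.
case: splitP => k ik.
  rewrite mxE (_ : i = ord0) ?tnth0//; apply: val_inj; by rewrite /= ik ord1.
rewrite mxE (_ : i = lift ord0 k) ?tnthS//; by apply: val_inj; rewrite /= ik.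
Qed.

End gauss.

Section qform_measurable.
Context {R : realType}.
Local Notation plane := (@lebesgue_plane R).

Lemma cmeasurable_sum d (T : measurableType d) (I : Type) (s : seq I) (f : I -> T -> R[i]) :
  (forall i, cmeasurable (f i)) -> cmeasurable (fun x => \sum_(i <- s) f i x).
Proof.
move=> mf; elim: s => [|i s [IH1 IH2]].
  by split; under eq_fun do rewrite big_nil; exact: measurable_cst.
have [m1 m2] := mf i.
split; under eq_fun do rewrite big_cons raddfD.
  exact: measurable_funD.
exact: measurable_funD.
Qed.

Lemma cmeasurable_conj d (T : measurableType d) (f : T -> R[i]) :
  cmeasurable f -> cmeasurable (fun x => Num.conj (f x)).
Proof.
move=> [m1 m2]; split.
  rewrite (_ : (fun x => _) = (fun x => complex.Re (f x)))//.
  by apply/funext => x; case: (f x).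
rewrite (_ : (fun x => _) = (fun x => - complex.Im (f x))); first exact: measurableT_comp.
by apply/funext => x; case: (f x).
Qed.

Lemma measurable_qform d (T : measurableType d) n (B : 'M[R[i]]_n) (X : T -> 'cV[R[i]]_n) :
  (forall i, cmeasurable (fun x => X x i 0)) ->
  measurable_fun setT (fun x => qform B (X x)).
Proof.
move=> mX; apply: (proj1 (_ : cmeasurable (fun x => herm B (X x)))).
rewrite (_ : (fun x => _) = fun x =>
    (\sum_j (\sum_i Num.conj (X x i 0) * B i j) * X x j 0)); last first.
  apply/funext => x; rewrite /herm mxE; apply: eq_bigr => j _.
  by rewrite mxE; congr (_ * _); apply: eq_bigr => i _; rewrite !mxE.
apply: cmeasurable_sum => j; apply: cmeasurableM => //.
apply: cmeasurable_sum => i; apply: cmeasurableM; first exact: cmeasurable_conj.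
by split; exact: measurable_cst.
Qed.

Lemma cmeasurable_col_of_tuple N i :
  cmeasurable (fun x : N.-tuple (planeC R) => col_of_tuple x i 0).
Proof.
have mt := @measurable_tnth _ (planeC R) N i.
split; under eq_fun do rewrite mxE /=.
  exact: (measurableT_comp measurable_fst mt).
exact: (measurableT_comp measurable_snd mt).
Qed.

(** Induction on the dimension: integrating out the first coordinate gives pi / a and leaves the
    Gaussian of the Schur complement, matching [det_schur]. The witness [r] is the determinant as a
    real number, to be used in a real integral. *)
Lemma integral_gauss_lebesgueC N (B : 'M[R[i]]_N) : posdefmx B ->
  exists r : R, [/\ (0 < r), \det B = r%:C &
  (\int[lebesgueC N]_x (expR (- qform B (col_of_tuple x)))%:E = (pi ^+ N / r)%:E)%E].
Proof.
have mq M (A : 'M[R[i]]_M) : measurable_fun setT (fun x => qform A (col_of_tuple x)).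
  by apply: measurable_qform => i; exact: cmeasurable_col_of_tuple.
elim: N B => [|N IHN] B pB.
  exists 1; split => //; first by rewrite det_mx00.
  rewrite expr0 divr1 /= integral_dirac//; last first.
    by apply/measurable_EFinP/measurable_expRN; exact: mq.
  rewrite diracT mul1e.
  rewrite (_ : col_of_tuple _ = 0); last by apply/matrixP => -[m lm].
  by rewrite /qform -/(herm B 0) herm0 /= oppr0 expR0.
pose B' : 'M[R[i]]_(1 + N) := B.
have pB' : posdefmx B' := pB.
have [r [r0 rE Ir]] := IHN _ (posdef_schur pB').
have a0 := posdef_corner_gt0 pB'.
pose a := complex.Re (ulsubmx B' 0 0).
have aE : ulsubmx B' 0 0 = a%:C.
  by rewrite /a; move: a0; case: (ulsubmx B' 0 0) => x y; rewrite ltcE /= => /andP[/eqP -> _].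
have ra0 : (0 < a) by move: a0; rewrite aE ltcR.
exists (a * r); split; first exact: mulr_gt0.
  by rewrite rmorphM/= -aE -rE -det_schur.
rewrite ge0_integral_lebesgueCS; last 2 first.
- by apply/measurable_EFinP/measurable_expRN; exact: mq.
- by move=> x; rewrite lee_fin expR_ge0.
transitivity (\int[lebesgueC N]_t ((pi / a)%:E * (expR (- qform (schur B') (col_of_tuple t)))%:E))%E.
  apply: eq_integral => t _.
  pose y := ((ulsubmx B' 0 0)^-1 * (ursubmx B' *m col_of_tuple t) 0 0).
  rewrite -(integral_gauss_plane (complex.Re y, complex.Im y) ra0).
  have mgz : measurable_fun setT (fun z : planeC R =>
      (expR (- (a * ((z.1 + complex.Re y) ^+ 2 + (z.2 + complex.Im y) ^+ 2))))%:E).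
    apply/measurable_EFinP/measurable_expRN; apply: measurable_funM => //.
    by apply: measurable_funD; apply: measurable_funX; exact: measurable_funD.
  rewrite -(ge0_integralZr _ measurableT mgz); last 2 first.
  - by move=> z _; rewrite lee_fin expR_ge0.
  - by rewrite lee_fin expR_ge0.
  apply: eq_integral => z _; rewrite -EFinM -expRD; congr (expR _)%:E.
  have := qform_schur pB' (const_mx ((z.1 : R) +i* (z.2 : R))) (col_of_tuple t).
  rewrite -col_of_tuple_tcons => ->.
  rewrite [const_mx _ 0 0]mxE -/y -/a; case: (y) => y1 y2 /=.
  by rewrite opprD.
have mS : measurable_fun setT
    (fun t : N.-tuple (planeC R) => (expR (- qform (schur B') (col_of_tuple t)))%:E).
  by apply/measurable_EFinP/measurable_expRN; exact: mq.
rewrite (ge0_integralZl _ measurableT mS)//; last first.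
  by rewrite lee_fin divr_ge0 ?pi_ge0// ltW.
rewrite Ir -EFinM; congr EFin.
by rewrite exprS invfM; ring.
Qed.

End qform_measurable.

(** * Block-diagonal matrices: the sum of the block forms as one form *)

Lemma big_tagnat_sig1 (S : comPzSemiRingType) (k : nat) (n : 'I_k -> nat) (F : 'I_k -> S) :
  \prod_(i < \sum_j n j) F (tagnat.sig1 i) = \prod_j F j ^+ n j.
Proof.
rewrite (reindex (@tagnat.rank k n)); last exact: onW_bij (@tagnat.rank_bij _ _).
transitivity (\prod_j \prod_(i < n j) F j); last first.
  by apply: eq_bigr => j _; rewrite prodr_const card_ord.
rewrite sig_big_dep /=; apply: eq_big => [[j i] //|[j i] _ /=].
by rewrite -[tagnat.rank _]/(tagnat.Rank j i) tagnat.Rank1K.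
Qed.

Lemma det_castmx (S : comPzRingType) (m n : nat) (e : m = n) (A : 'M[S]_m) :
  \det (castmx (e, e) A) = \det A.
Proof. by case: n / e; rewrite castmx_id. Qed.

Lemma det_mxdiag (S : comPzRingType) (k : nat) (n : 'I_k -> nat)
    (B : forall j, 'M[S]_(n j)) :
  \det (\mxdiag_j B j) = \prod_j \det (B j).
Proof.
elim: k n B => [|k IHk] n B.
  have det0 m (M : 'M[S]_m) : m = 0%N -> \det M = 1.
    by move=> m0; move: M; rewrite m0 => M; exact: det_mx00.
  by rewrite [RHS]big_ord0 det0// big_ord0.
by rewrite mxdiag_recl det_castmx det_ublock big_ord_recl IHk.
Qed.

Section mxdiag_posdef.
Context {R : realType} {k : nat} {n : 'I_k -> nat}.
Variable B : forall j : 'I_k, 'M[R[i]]_(n j).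

(** Turns the Gaussian in all blocks into a single Gaussian on the total space, whose determinant is
    the product of those of the blocks. *)
Lemma herm_mxdiag (X : 'cV[R[i]]_(\sum_j n j)) :
  herm (\mxdiag_j B j) X = \sum_j herm (B j) (submxcol X j).
Proof.
rewrite /herm -[X in (_ *m _ *m X) 0 0](submxcolK X) -mulmxA mul_mxdiag_mxcol.
have -> : X ^t* = \mxrow_j ((submxcol X j) ^t*).
  by apply/matrixP => i j; rewrite !mxE -[in LHS](tagnat.sig2K j).
rewrite mul_mxrow_mxcol summxE.
by apply: eq_bigr => j _; rewrite mulmxA.
Qed.

Hypothesis pB : forall j, posdefmx (B j).

Lemma posdef_mxdiag : posdefmx (\mxdiag_j B j).
Proof.
apply: posdefP.
  rewrite tr_mxdiag; apply/matrixP => s s'; rewrite !mxE /tagnat.sig1 /tagnat.sig2.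
  case: (tagnat.sig s) (tagnat.sig s') => [/= i x] [/= i' x'].
  case: (eqVneq i i') => ii'; last by rewrite !mxE rmorph0.
  case: _ / ii' in x' *; rewrite !conform_mx_id -[in RHS](posdef_adj (pB i)).
  by rewrite !mxE.
move=> X X0; rewrite herm_mxdiag.
have [j Xj] : exists j, submxcol X j != 0.
  apply/existsP; apply: contraNT X0 => /existsPn X0.
  rewrite -(submxcolK X); apply/eqP/matrixP => s i; rewrite !mxE.
  have /eqP := negbNE (X0 (tagnat.sig1 s)).
  by move=> /matrixP/(_ (tagnat.sig2 s) i); rewrite !mxE.
rewrite (bigD1 j)//= ltr_wpDr ?posdef_gt0//.
by apply: sumr_ge0 => i _; rewrite hermE// lecR qform_ge0.
Qed.

Lemma qform_mxdiag (X : 'cV[R[i]]_(\sum_j n j)) :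
  qform (\mxdiag_j B j) X = \sum_j qform (B j) (submxcol X j).
Proof. by rewrite /qform -/(herm _ X) herm_mxdiag raddf_sum. Qed.

End mxdiag_posdef.

(** * Polar decomposition along dilations *)

Section polar_complex.
Context d (T : measurableType d) (R : realType)
  (mu : {sigma_finite_measure set T -> \bar R}) (dil : R -> T -> T) (m : nat).
Local Notation leb := (@lebesgue_measure R).
Local Notation pos := (`]0%R, +oo[%classic : set R).

Hypothesis m0 : (0 < m)%N.
Hypothesis mdil : forall s, measurable_fun setT (dil s).
Hypothesis scale : forall s, 0 < s -> forall f : T -> \bar R,
  measurable_fun setT f -> (forall x, (0 <= f x)%E) ->
  (\int[mu]_x f x = (s ^+ m)%:E * \int[mu]_x f (dil s x))%E.

Variables (D : set T) (q h1 : T -> R).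
Hypotheses (mD : measurable D) (mq : measurable_fun setT q)
  (mh1 : measurable_fun setT h1).
Hypothesis D_dil : forall s x, 0 < s -> D (dil s x) <-> D x.
Hypothesis q_dil : forall s x, 0 < s -> q (dil s x) = s * q x.
Hypothesis h1_dil : forall s x, 0 < s -> h1 (dil s x) = h1 x.
Hypothesis h10 : forall x, 0 <= h1 x.
Hypothesis Dq : forall x, D x -> 0 < q x.
Hypothesis h1_gt0 : (0 < \int[mu]_(x in D) (h1 x * expR (- q x))%:E)%E.
Hypothesis h1_lty : (\int[mu]_(x in D) (h1 x * expR (- q x))%:E < +oo)%E.

Let mpos : measurable (pos : set (measurableTypeR R)).
Proof. by []. Qed.

Let m1 : m = m.-1.+1. Proof. by rewrite prednK. Qed.

Let gammaE :
  (\int[leb]_(u in pos) (u ^+ m.-1 * expR (- u))%:E = (rgamma m%:R)%:E)%E.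
Proof.
rewrite -rgammaE ?ltr0n//; apply: eq_integral => u /set_mem/posP u0.
congr (_ * _)%:E; rewrite -[in RHS](prednK m0) -addn1 natrD addrK mulr_natl.
by rewrite -lnXn// lnK// posrE exprn_gt0.
Qed.

(** [D] is stable under dilations, so its indicator can be absorbed into the invariant factor; [q]
    is then positive wherever that factor is nonzero, as [polar_aux] demands. *)
Let dom (h : T -> R) x : R := h x * \1_D x.

Let domE (h g : T -> R) :
  (\int[mu]_x (dom h x * g x)%:E = \int[mu]_(x in D) (h x * g x)%:E)%E.
Proof.
rewrite [RHS]integral_mkcond; apply: eq_integral => x _; rewrite /dom patchE indicE.
by case: ifPn => _; rewrite ?mulr1// mulr0 mul0r.
Qed.

Let indD s x : 0 < s -> \1_D (dil s x) = \1_D x :> R.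
Proof.
move=> s0; rewrite !indicE; congr (_%:R); congr nat_of_bool; apply/idP/idP.
  by move=> /set_mem/(D_dil x s0)/mem_set.
by move=> /set_mem Dx; apply/mem_set/(D_dil x s0).
Qed.

Lemma polar (h : T -> R) (g : R -> R) :
  measurable_fun setT h -> measurable_fun setT g ->
  (forall x, 0 <= h x) -> (forall x, 0 <= g x) ->
  (forall s x, 0 < s -> D x -> h (dil s x) = h x) ->
  ((rgamma m%:R)%:E * \int[mu]_(x in D) (h x * g (q x))%:E =
  \int[mu]_(x in D) (h x * expR (- q x))%:E * \int[leb]_(u in pos) (u ^+ m.-1 * g u)%:E)%E.
Proof.
pose K := (\int[leb]_(v in pos) (v^-1 ^+ m.-1.+2 * expR (- v^-1))%:E)%E.
have aux (h' : T -> R) (g' : R -> R) :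
  measurable_fun setT h' -> measurable_fun setT g' ->
  (forall x, 0 <= h' x) -> (forall x, 0 <= g' x) ->
  (forall s x, 0 < s -> D x -> h' (dil s x) = h' x) ->
  (K * \int[mu]_(x in D) (h' x * g' (q x))%:E =
  \int[mu]_(x in D) (h' x * expR (- q x))%:E * \int[leb]_(u in pos) (u ^+ m.-1 * g' u)%:E)%E.
  move=> mh mg h0 g0 h_dil; rewrite -!domE; apply: (polar_aux mdil) => //.
  - by rewrite -m1.
  - by apply: measurable_funM => //; exact: measurable_indic.
  - move=> s x s0; rewrite /dom indD// indicE.
    by have [/set_mem Dx|_] := boolP (x \in D); [rewrite h_dil|rewrite !mulr0].
  - by move=> x; rewrite /dom mulr_ge0// indicE.
  - move=> x; rewrite /dom indicE; have [/set_mem Dx _|_] := boolP (x \in D).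
      exact: Dq.
    by rewrite mulr0 eqxx.
(* K is Gamma (m) after t = 1 / v; testing the formula on h1 and u |-> e^(-u)
   gives this without that substitution. *)
have KE : K = (rgamma m%:R)%:E.
  have := aux h1 (fun u => expR (- u)) mh1 _ h10 _ _.
  rewrite gammaE => /(_ _ _ _).
  set I := (\int[mu]_(x in D) _)%E => H.
  have {}H : (K * I = I * (rgamma m%:R)%:E)%E.
    apply: H => [|x|s x s0 _]; [exact: measurable_expRN|exact: expR_ge0|exact: h1_dil].
  have If : I \is a fin_num by rewrite ge0_fin_numE ?ltW.
  have : (K * I * (fine I)^-1%:E = (rgamma m%:R)%:E * (I * (fine I)^-1%:E))%E.
    by rewrite H muleA [(_ * I)%E]muleC.
  rewrite -muleA.
  have -> : (I * (fine I)^-1%:E = 1)%E.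
    by rewrite -[X in (X * _)%E](fineK If) -EFinM divff// gt_eqF// fine_gt0// h1_gt0.
  by rewrite !mule1.
by move=> mh mg h0 g0 h_dil; rewrite -KE; exact: aux.
Qed.

Lemma polar_cintegral (F : T -> R[i]) (G : R -> R[i]) :
  cmeasurable F -> cmeasurable G ->
  (forall s x, 0 < s -> D x -> F (dil s x) = F x) ->
  cintegrable mu D (fun x => (expR (- q x))%:C * F x) ->
  cintegrable leb pos (fun u => (u ^+ m.-1)%:C * G u) ->
  cintegrable mu D (fun x => F x * G (q x)) /\
  (rgamma m%:R)%:C * cintegral mu D (fun x => F x * G (q x)) =
  cintegral mu D (fun x => (expR (- q x))%:C * F x) *
  cintegral leb pos (fun u => (u ^+ m.-1)%:C * G u).
Proof.
move=> mF mG F_dil iF iG.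
(* [F] is factored through the plane because every real function of the pair of its parts, in
   particular their positive and negative parts, inherits dilation invariance. *)
pose P (x : T) : planeC R := (complex.Re (F x), complex.Im (F x)).
pose f (z : planeC R) : R[i] := (z.1 : R) +i* (z.2 : R).
have FE x : F x = f (P x) by rewrite /f /P /=; case: (F x).
have r0 : 0 < rgamma (m%:R : R) by rewrite (@rgamma_gt0 R)// ltr0n.
have mP : measurable_fun setT P by apply: measurable_fun_pair; case: mF.
have mf : cmeasurable f by split; [exact: measurable_fst|exact: measurable_snd].
have H : product_formula mu mu leb D D pos (cst (rgamma m%:R)) (fun x => expR (- q x))
   (fun u => u ^+ m.-1) P P q id.
  move=> f' g' mf' mg' f0 g0; under eq_integral do rewrite /cst EFinM.
  rewrite ge0_integralZl//; last 3 first.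
  - apply/measurable_EFinP/measurable_funTS; apply: measurable_funM.
      exact: (measurableT_comp mf').
    exact: (measurableT_comp mg').
  - by move=> x _; rewrite lee_fin mulr_ge0.
  - by rewrite lee_fin ltW.
  rewrite (polar (h := f' \o P))//.
  - by congr (_ * _)%E; apply: eq_integral => x _; rewrite mulrC.
  - exact: measurableT_comp.
  - by move=> x; exact: f0.
  - by move=> s x s0 Dx; rewrite /P /= F_dil.
have iF' : cintegrable mu D (fun x => (expR (- q x))%:C * f (P x)).
  by apply: eq_cintegrable iF => // x _; rewrite FE.
have w20 u : pos u -> 0 <= u ^+ m.-1 by move=> /posP/ltW; exact: exprn_ge0.
have [I1 E1] := product_formula_cintegral mD mD mpos (@measurable_cst _ _ _ _ _ _)
  (measurable_expRN mq) (measurable_funX _ (@measurable_id _ _ _)) mP mP mq (@measurable_id _ _ _)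
  (fun x _ => ltW r0) (fun x _ => expR_ge0 _) w20 H mf mG iF' iG.
have I2 : cintegrable mu D (fun x => F x * G (q x)).
  have := cintegrableZ ((rgamma m%:R)^-1)%:C mD I1.
  apply: eq_cintegrable => // x _; rewrite -FE mulrA -(rmorphM (real_complex R)).
  by rewrite mulVf ?gt_eqF// mul1r.
split => //; rewrite -[LHS]cintegralZ//.
transitivity (cintegral mu D (fun x => (rgamma m%:R)%:C * (f (P x) * G (q x)))).
  by apply: eq_cintegral => x _; rewrite FE.
by rewrite E1; congr (_ * _); apply: eq_cintegral => x _; rewrite FE.
Qed.

End polar_complex.

(** * Block forms, their dilations and the set of nonzero blocks *)

Section blocks.
Context {R : realType} {k : nat} {n : 'I_k -> nat}.
Hypothesis hn : forall j, (0 < n j)%N.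
Variable B : forall j : 'I_k, 'M[R[i]]_(n j).
Hypothesis pB : forall j, posdefmx (B j).
Local Notation N := (\sum_j n j)%N.
Local Notation T := (N.-tuple (planeC R)).
Local Notation mu := (@lebesgueC R N).
Local Notation D := (@nonzero_blocks R k n).

Definition Qf (j : 'I_k) (x : T) : R := qform (B j) (blocks_of_tuple x j).

Definition Qsum (J : pred 'I_k) (x : T) : R := \sum_(j | J j) Qf j x.

Lemma measurable_Qf j : measurable_fun setT (Qf j).
Proof.
apply: measurable_qform => i; rewrite /blocks_of_tuple.
rewrite (_ : (fun x => _) = (fun x => col_of_tuple x (tagnat.Rank j i) 0)).
  exact: cmeasurable_col_of_tuple.
by apply/funext => x; rewrite mxE.
Qed.

Lemma measurable_Qsum J : measurable_fun setT (Qsum J).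
Proof.
rewrite (_ : Qsum J = fun x => \sum_j (if J j then Qf j x else 0)); last first.
  by apply/funext => x; exact: big_mkcond.
by apply: measurable_sum => j; case: (J j); [exact: measurable_Qf|exact: measurable_cst].
Qed.

Lemma Qf_ge0 j x : 0 <= Qf j x. Proof. exact: qform_ge0. Qed.

Lemma nonzero_blocksP x : D x <-> forall j, 0 < Qf j x.
Proof.
split=> [Dx j|H j]; first exact: qform_gt0 (Dx j).
apply/eqP => x0; have := H j.
by rewrite /Qf x0 /qform -/(herm (B j) 0) herm0 ltxx.
Qed.

Lemma Qf_gt0 j x : D x -> 0 < Qf j x. Proof. by move=> /nonzero_blocksP. Qed.

Lemma measurable_nonzero_blocks : measurable D.
Proof.
rewrite (_ : D = \bigcap_(j in [set: 'I_k]) (Qf j @^-1` `]0, +oo[)); last first.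
  apply/seteqP; split=> x.
    by move=> Dx j _ /=; rewrite in_itv/= andbT; exact: Qf_gt0.
  move=> H; apply/nonzero_blocksP => j; have := H j I.
  by rewrite /= in_itv/= andbT.
apply: fin_bigcap_measurable => // j _.
rewrite -[X in measurable X]setTI; exact: measurable_Qf.
Qed.

(** Vectors are multiplied by the square root so that the forms scale by s itself; each complex
    coordinate then contributes one factor s to the measure. It is used with [J] a single block and
    with [J] all blocks. *)
Definition dil (J : pred 'I_k) (s : R) : T -> T :=
  scale_tuple (fun i => if J (tagnat.sig1 i) then Num.sqrt s else 1).

Lemma blocks_dil J s x j :
  blocks_of_tuple (dil J s x) j =
  (if J j then Num.sqrt s else 1)%:C *: blocks_of_tuple x j.
Proof.
apply/matrixP => i l; rewrite !mxE tnth_scale_tuple tagnat.Rank1K /=.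
by case: ifP => _; simpc.
Qed.

Lemma qform_scale p (A : 'M[R[i]]_p) (c : R) X :
  qform A (c%:C *: X) = c ^+ 2 * qform A X.
Proof.
rewrite /qform adj_mxZ -!scalemxAl -scalemxAr scalerA mxE conj_complex oppr0.
by rewrite -(rmorphM (real_complex R)) complex_ReZ expr2.
Qed.

Lemma Qf_dil J s x j : 0 < s -> Qf j (dil J s x) = (if J j then s else 1) * Qf j x.
Proof.
move=> s0; rewrite /Qf blocks_dil qform_scale; case: ifP => _.
  by rewrite sqr_sqrtr ?ltW.
by rewrite expr1n.
Qed.

Lemma Qsum_dil J s x : 0 < s -> Qsum J (dil J s x) = s * Qsum J x.
Proof.
move=> s0; rewrite /Qsum mulr_sumr; apply: eq_bigr => j Jj.
by rewrite Qf_dil// Jj.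
Qed.

Lemma nonzero_blocks_dil J s x : 0 < s -> D (dil J s x) <-> D x.
Proof.
move=> s0; rewrite !nonzero_blocksP; split=> H j; have := H j; rewrite Qf_dil//.
  by case: ifP => _; rewrite ?mul1r// pmulr_rgt0.
by case: ifP => _; rewrite ?mul1r// pmulr_rgt0.
Qed.

Lemma measurable_dil J s : measurable_fun setT (dil J s).
Proof. exact: measurable_scale_tuple. Qed.

Lemma ge0_integral_dil J s (f : T -> \bar R) : 0 < s ->
  measurable_fun setT f -> (forall x, (0 <= f x)%E) ->
  (\int[mu]_x f x = (s ^+ (\sum_(j | J j) n j))%:E * \int[mu]_x f (dil J s x))%E.
Proof.
move=> s0 mf f0.
rewrite (@ge0_integral_scale_tuple _ _ (fun i => if J (tagnat.sig1 i) then Num.sqrt s else 1))//.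
  congr (_%:E * _)%E.
  rewrite (big_tagnat_sig1 n (fun j => (if J j then Num.sqrt s else 1) ^+ 2)).
  rewrite -prodrXr [RHS]big_mkcond; apply: eq_bigr => j _.
  by case: ifP => _; rewrite ?sqr_sqrtr ?ltW// !expr1n.
by move=> i; case: ifP => _ //; rewrite sqrtr_gt0.
Qed.

(** A vanishing block has a vanishing first coordinate, so the complement lies in finitely many
    boxes with one side reduced to a point of the plane. *)
Lemma negligible_zero_blocks : mu (~` D) = 0%E.
Proof.
apply/negligibleP; first exact: measurableC measurable_nonzero_blocks.
pose Z (j : 'I_k) : set T := [set x | blocks_of_tuple x j = 0].
pose F (i : nat) : set T := if insub i is Some j then Z j else set0.
apply: (@negligibleS _ _ _ _ (\bigcup_i F i)).
  move=> x /existsNP[j /negP/negPn/eqP xj]; exists (val j) => //.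
  by rewrite /F valK.
apply: negligible_bigcup => i; rewrite /F.
case: insub => [j|]; last exact: negligible_set0.
pose i0 : 'I_N := tagnat.Rank j (Ordinal (hn j)).
pose A (l : 'I_N) : set (planeC R) := if l == i0 then [set (0, 0)] else setT.
have s00 : [set (0, 0)] = [set 0] `*` [set 0] :> set (planeC R).
  by apply/seteqP; split=> -[a b] /= [-> ->].
have mA l : measurable (A l).
  by rewrite /A; case: ifP => _ //; rewrite s00; exact: measurableX.
apply: (@negligibleS _ _ _ _ [set t | forall l, A l (tnth t l)]).
  move=> x xj l; rewrite /A; case: eqP => // ->.
  have := congr1 (fun M : 'cV_(n j) => M (Ordinal (hn j)) 0) xj; rewrite !mxE /=.
  by rewrite -/i0; case: (tnth x i0) => a b /= [-> ->].
apply/negligibleP.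
  rewrite [X in measurable X](_ : _ = \bigcap_(l in [set: 'I_N])
      ((fun t : T => tnth t l) @^-1` A l)); last first.
    by apply/seteqP; split=> t /= At l => [_|]; [exact: At|exact: (At l I)].
  apply: fin_bigcap_measurable => // l _.
  have := @measurable_tnth _ (planeC R) N l measurableT _ (mA l).
  by rewrite setTI.
(* The other sides of the box are whole planes; the product is still 0, since 0 times +oo is 0 in
   the extended reals. *)
rewrite [LHS](measure_power_box _ mA) (bigD1 i0)//= {1}/A eqxx.
rewrite (_ : lebesgue_plane _ = 0%E) ?mul0e//.
by rewrite s00 /lebesgue_plane product_measure1E//= lebesgue_measure_set1 mul0e.
Qed.

Lemma integral_gauss_blocks : exists r : R, [/\ 0 < r, \prod_j \det (B j) = r%:C &
  (\int[mu]_(x in D) (expR (- Qsum predT x))%:E = (pi ^+ N / r)%:E)%E].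
Proof.
have [r [r0 rE Ir]] := integral_gauss_lebesgueC (posdef_mxdiag pB).
exists r; split => //; first by rewrite -det_mxdiag.
have QE x : Qsum predT x = qform (\mxdiag_j B j) (col_of_tuple x).
  by rewrite qform_mxdiag.
have -> : D = setT `\` ~` D by rewrite setTD setCK.
rewrite -ge0_negligible_integral//.
- by rewrite -Ir; apply: eq_integral => x _; rewrite QE.
- exact: measurableC measurable_nonzero_blocks.
- by apply/measurable_EFinP/measurable_expRN; exact: measurable_Qsum.
- exact: negligible_zero_blocks.
Qed.

End blocks.

Section complex_norm.
Context {R : realType}.
Implicit Types (x : R) (a z : R[i]).

Lemma normc_cpow x a : `|cpow x a| = (expR (complex.Re a * ln x))%:C.
Proof.
rewrite normc_def Re_cpow Im_cpow !exprMn -mulrDr cos2Dsin2 mulr1.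
by rewrite sqrtr_sqr ger0_norm ?expR_ge0.
Qed.

Lemma Re_Im_le_normc z (r : R) : `|z| = r%:C ->
  `|complex.Re z| <= r /\ `|complex.Im z| <= r.
Proof.
rewrite normc_def => -[<-]; rewrite -!sqrtr_sqr; split; apply: ler_wsqrtr.
  by rewrite lerDl sqr_ge0.
by rewrite lerDr sqr_ge0.
Qed.

Lemma cpow_sum (I : Type) (s : seq I) x (a : I -> R[i]) :
  cpow x (\sum_(i <- s) a i) = \prod_(i <- s) cpow x (a i).
Proof.
elim: s => [|i s IHs]; first by rewrite !big_nil cpow_0r.
by rewrite !big_cons cpowD IHs.
Qed.

Lemma cmeasurable_prod d (T : measurableType d) (I : Type) (s : seq I)
    (P : pred I) (f : I -> T -> R[i]) :
  (forall i, cmeasurable (f i)) -> cmeasurable (fun w => \prod_(i <- s | P i) f i w).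
Proof.
move=> mf; elim: s => [|i s IHs].
  rewrite (_ : (fun w => _) = (fun=> 1)); first by split; exact: measurable_cst.
  by apply/funext => w; rewrite big_nil.
rewrite (_ : (fun w => _) = (fun w =>
    (if P i then f i w else 1) * \prod_(i <- s | P i) f i w)).
  by apply: cmeasurableM => //; case: (P i) => //; split; exact: measurable_cst.
by apply/funext => w; rewrite big_cons; case: ifP; rewrite ?mul1r.
Qed.

Lemma cGamma_nat p : cGamma (p%:R : R[i]) = (rgamma (p%:R : R))%:C.
Proof. by rewrite -(rmorph_nat (real_complex R)) cGamma_real. Qed.

End complex_norm.

(** * Gamma-type integrals over the blocks *)

Section average.
Context {R : realType} {k : nat} {n : 'I_k -> nat}.
Hypothesis hk : (0 < k)%N.
Hypothesis hn : forall j, (0 < n j)%N.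
Variable B : forall j : 'I_k, 'M[R[i]]_(n j).
Hypothesis pB : forall j, posdefmx (B j).
Local Notation N := (\sum_j n j)%N.
Local Notation T := (N.-tuple (planeC R)).
Local Notation mu := (@lebesgueC R N).
Local Notation D := (@nonzero_blocks R k n).
Local Notation leb := (@lebesgue_measure R).
Local Notation pos := (`]0%R, +oo[%classic : set R).

Let mD : measurable (D : set T). Proof. exact: measurable_nonzero_blocks. Qed.

Lemma Qsum_gt0 (J : pred 'I_k) j (x : T) : J j -> D x -> 0 < Qsum B J x.
Proof.
move=> Jj Dx; rewrite /Qsum (bigD1 j)//= ltr_wpDr ?Qf_gt0//.
by apply: sumr_ge0 => i _; exact: Qf_ge0.
Qed.

(** The calibrating function for [polar]: the Gaussian in the blocks outside [J] is invariant under
    [dil J], and multiplied by e^(-q) for the blocks in [J] it becomes the full Gaussian, whose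
    integral is known to be positive and finite. *)
Let h1 (J : pred 'I_k) (x : T) : R := expR (- Qsum B (predC J) x).

Let h1E J x : h1 J x * expR (- Qsum B J x) = expR (- Qsum B predT x).
Proof.
rewrite -expRD -opprD; congr (expR (- _)).
by rewrite /Qsum [RHS](bigID J)/= addrC.
Qed.

Section polarJ.
Variables (J : pred 'I_k) (j : 'I_k).
Hypothesis Jj : J j.

Let m := (\sum_(j | J j) n j)%N.

Let m0 : (0 < m)%N.
Proof. by rewrite /m (bigD1 j)//= addn_gt0 hn. Qed.

Let h1_dil s x : 0 < s -> h1 J (dil J s x) = h1 J x.
Proof.
move=> s0; rewrite /h1 /Qsum; congr (expR (- _)); apply: eq_bigr => i /negbTE Ji.
by rewrite Qf_dil// Ji mul1r.
Qed.

Let mh1 : measurable_fun setT (h1 J).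
Proof. by apply: measurable_expRN; exact: measurable_Qsum. Qed.

Let h1_int : (\int[mu]_(x in D) (h1 J x * expR (- Qsum B J x))%:E =
  \int[mu]_(x in D) (expR (- Qsum B predT x))%:E)%E.
Proof. by apply: eq_integral => x _; rewrite h1E. Qed.

Let h1_gt0 : (0 < \int[mu]_(x in D) (h1 J x * expR (- Qsum B J x))%:E)%E.
Proof.
have [r [r0 _ Ir]] := integral_gauss_blocks hn pB.
by rewrite h1_int Ir lte_fin divr_gt0// exprn_gt0// pi_gt0.
Qed.

Let h1_lty : (\int[mu]_(x in D) (h1 J x * expR (- Qsum B J x))%:E < +oo)%E.
Proof.
have [r [r0 _ Ir]] := integral_gauss_blocks hn pB.
by rewrite h1_int Ir ltry.
Qed.

Definition polar_blocks := polar m0 (measurable_dil J)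
  (fun s s0 f => @ge0_integral_dil R k n J s f s0) mD (@measurable_Qsum R k n B J) mh1
  (fun s x s0 => @nonzero_blocks_dil R k n B pB J s x s0) (fun s x s0 => @Qsum_dil R k n B J s x s0) h1_dil
  (fun x => expR_ge0 _) (fun x => Qsum_gt0 Jj) h1_gt0 h1_lty.

Definition polar_cintegral_blocks := polar_cintegral m0 (measurable_dil J)
  (fun s s0 f => @ge0_integral_dil R k n J s f s0) mD (@measurable_Qsum R k n B J) mh1
  (fun s x s0 => @nonzero_blocks_dil R k n B pB J s x s0) (fun s x s0 => @Qsum_dil R k n B J s x s0) h1_dil
  (fun x => expR_ge0 _) (fun x => Qsum_gt0 Jj) h1_gt0 h1_lty.

End polarJ.

Definition gamma_blocks (b : 'I_k -> R[i]) (x : T) : R[i] :=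
  \prod_j (cpow (Qf B j x) (b j) * (expR (- Qf B j x))%:C).

(** Polar decomposition in block [j] alone: the other blocks form the invariant factor. As
    [b j = 0], that factor times the exponential of block [j] is already [gamma_blocks b], while the
    radial integral with the new exponent is a Gamma value. *)
Lemma gamma_blocks_step (j : 'I_k) (b b' : 'I_k -> R[i]) :
  b j = 0 -> (forall i, i != j -> b' i = b i) -> 0 < complex.Re (b' j + (n j)%:R) ->
  cintegrable mu D (gamma_blocks b) ->
  cintegrable mu D (gamma_blocks b') /\
  cGamma (n j)%:R * cintegral mu D (gamma_blocks b') =
  cintegral mu D (gamma_blocks b) * cGamma (b' j + (n j)%:R).
Proof.
move=> bj0 bb' bj ib.
pose F (x : T) := \prod_(i | i != j) (cpow (Qf B i x) (b i) * (expR (- Qf B i x))%:C).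
pose G (u : R) := cpow u (b' j) * (expR (- u))%:C.
have QE x : Qsum B (pred1 j) x = Qf B j x by rewrite /Qsum big_pred1_eq.
have nE : (\sum_(i | pred1 j i) n i)%N = n j by rewrite big_pred1_eq.
have bE x : (expR (- Qsum B (pred1 j) x))%:C * F x = gamma_blocks b x.
  by rewrite QE /gamma_blocks [RHS](bigD1 j)//= bj0 cpow_0r mul1r.
have b'E x : F x * G (Qsum B (pred1 j) x) = gamma_blocks b' x.
  rewrite QE /gamma_blocks [RHS](bigD1 j)//= mulrC; congr (_ * _).
  by apply: eq_bigr => i ij; rewrite bb'.
have GE (u : R) : 0 < u -> (u ^+ (n j).-1)%:C * G u = gamma_int (b' j + (n j)%:R) u.
  move=> u0; rewrite /G /gamma_int mulrA -cpow_natr// -cpowD; congr (cpow u _ * _).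
  by rewrite -[in RHS](prednK (hn j)) -addn1 natrD addrA addrK addrC.
have mQ i : measurable_fun setT (Qf B i) by exact: measurable_Qf.
have mF : cmeasurable F.
  apply: cmeasurable_prod => i; apply: cmeasurableM.
    exact: (cmeasurable_comp (cmeasurable_cpow _)).
  by apply: cmeasurable_real; exact: measurable_expRN.
have mG : cmeasurable G.
  apply: cmeasurableM; first exact: cmeasurable_cpow.
  by apply: cmeasurable_real; exact: measurable_expRN.
have F_dil s x : 0 < s -> D x -> F (dil (pred1 j) s x) = F x.
  move=> s0 _; apply: eq_bigr => i /negbTE ij.
  by rewrite Qf_dil//= ij mul1r.
have iF : cintegrable mu D (fun x => (expR (- Qsum B (pred1 j) x))%:C * F x).
  by apply: eq_cintegrable ib => // x _; rewrite bE.
have iG : cintegrable leb pos (fun u => (u ^+ (\sum_(i | pred1 j i) n i)%N.-1)%:C * G u).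
  rewrite nE; apply: eq_cintegrable (cintegrable_gamma bj) => //.
  by move=> u /set_mem/posP u0; rewrite GE.
have [I1 E1] := @polar_cintegral_blocks (pred1 j) j (eqxx j) F G mF mG F_dil iF iG.
split; first by apply: eq_cintegrable I1 => // x _; exact: b'E.
have EL : cintegral mu D (fun x => F x * G (Qsum B (pred1 j) x)) =
    cintegral mu D (gamma_blocks b') by apply: eq_cintegral => x _; exact: b'E.
have ER : cintegral mu D (fun x => (expR (- Qsum B (pred1 j) x))%:C * F x) =
    cintegral mu D (gamma_blocks b) by apply: eq_cintegral => x _; exact: bE.
rewrite EL ER nE in E1; rewrite cGamma_nat E1 cGammaE; congr (_ * _).
by apply: eq_cintegral => u /set_mem/posP u0; exact: GE.
Qed.

Lemma gamma_blocks_integral (a : 'I_k -> R[i]) :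
  (forall j, 0 < complex.Re (a j + (n j)%:R)) ->
  exists r : R, [/\ 0 < r, \prod_j \det (B j) = r%:C,
    cintegrable mu D (gamma_blocks a) &
    cintegral mu D (gamma_blocks a) = (pi ^+ N / r)%:C *
      \prod_j (cGamma (a j + (n j)%:R) / cGamma (n j)%:R)].
Proof.
move=> a0; have [r [r0 rE Ir]] := integral_gauss_blocks hn pB.
exists r; suff [ia Ea] : cintegrable mu D (gamma_blocks a) /\
    cintegral mu D (gamma_blocks a) = (pi ^+ N / r)%:C *
      \prod_j (cGamma (a j + (n j)%:R) / cGamma (n j)%:R) by split.
(* Exponents are switched on one by one along a duplicate-free list: the empty list is the Gaussian,
   and each new index still carries exponent 0, as [gamma_blocks_step] requires. *)
pose b (s : seq 'I_k) i : R[i] := if i \in s then a i else 0.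
suff H (s : seq 'I_k) : uniq s -> cintegrable mu D (gamma_blocks (b s)) /\
    cintegral mu D (gamma_blocks (b s)) = (pi ^+ N / r)%:C *
      \prod_(j <- s) (cGamma (a j + (n j)%:R) / cGamma (n j)%:R).
  have [ib Eb] := H (index_enum 'I_k) (index_enum_uniq _).
  suff E : b (index_enum 'I_k) = a by rewrite E in ib Eb.
  by apply/funext => j; rewrite /b mem_index_enum.
elim: s => [_|j s IHs /= /andP[js us]].
  have E x : gamma_blocks (b [::]) x = (expR (- Qsum B predT x))%:C.
    rewrite /gamma_blocks; under eq_bigr do rewrite cpow_0r mul1r.
    by rewrite -(rmorph_prod (real_complex R)) -expR_sum sumrN.
  have ie : mu.-integrable D (EFin \o (fun x => expR (- Qsum B predT x))).
    apply/integrableP; split.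
      apply/measurable_EFinP/measurable_funTS/measurable_expRN.
      exact: measurable_Qsum.
    under eq_integral => x _ do rewrite /= ger0_norm ?expR_ge0//.
    by rewrite Ir ltry.
  split.
    split.
      by apply: eq_integrable ie => // x _ /=; rewrite E.
    apply: (@eq_integrable _ _ _ mu D mD (cst 0%E)); last exact: integrable0.
    by move=> x _ /=; rewrite E.
  rewrite big_nil mulr1 /cintegral; congr (_ +i* _).
    under eq_Rintegral do rewrite E.
    by rewrite /Rintegral Ir.
  under eq_Rintegral do rewrite E.
  by rewrite /Rintegral integral0.
have [ib Eb] := IHs us.
have bj0 : b s j = 0 by rewrite /b (negbTE js).
have bj : b (j :: s) j = a j by rewrite /b inE eqxx.
have bb' i : i != j -> b (j :: s) i = b s i by rewrite /b inE => /negbTE ->.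
have := @gamma_blocks_step j (b s) (b (j :: s)) bj0 bb'; rewrite bj => /(_ (a0 j) ib)[ib' E].
split => //; rewrite big_cons.
have gn : cGamma (n j)%:R != 0 :> R[i].
  by apply: cGamma_neq0; rewrite -(rmorph_nat (real_complex R)) /= ltr0n hn.
apply: (mulfI gn); rewrite E Eb.
set G0 := (_ / r)%:C; set P := \prod_(i <- s) _; set X := cGamma (a j + _).
by move: gn; set Y := cGamma _ => gn; field; rewrite gn fmorph_eq0 gt_eqF.
Qed.

End average.

(** * Dirichlet averages *)

Section homogeneous.
Context {R : realType} {k : nat} {n : 'I_k -> nat}.
Hypothesis hk : (0 < k)%N.
Hypothesis hn : forall j, (0 < n j)%N.
Variable B : forall j : 'I_k, 'M[R[i]]_(n j).
Hypothesis pB : forall j, posdefmx (B j).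
Local Notation N := (\sum_j n j)%N.
Local Notation T := (N.-tuple (planeC R)).
Local Notation mu := (@lebesgueC R N).
Local Notation D := (@nonzero_blocks R k n).
Local Notation leb := (@lebesgue_measure R).
Local Notation pos := (`]0%R, +oo[%classic : set R).
Local Notation q := (Qsum B predT).

Variable a : 'I_k -> R[i].
Hypothesis a0 : forall j, 0 < complex.Re (a j + (n j)%:R).

Let A := \sum_j a j.

Let mD : measurable (D : set T). Proof. exact: measurable_nonzero_blocks. Qed.

Let mpos : measurable (pos : set (measurableTypeR R)). Proof. by []. Qed.

Let q_gt0 (x : T) : D x -> 0 < q x.
Proof. by move=> Dx; exact: (@Qsum_gt0 _ _ _ B pB predT (Ordinal hk)). Qed.

Let N0 : (0 < N)%N.
Proof. by rewrite (bigD1 (Ordinal hk))//= addn_gt0 hn. Qed.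

Definition angular (x : T) : R[i] :=
  (\prod_j cpow (Qf B j x) (a j)) * cpow (q x) (- A).

Let cmeasurable_angular : cmeasurable angular.
Proof.
apply: cmeasurableM.
  apply: cmeasurable_prod => j; apply: (cmeasurable_comp (cmeasurable_cpow _)).
  exact: measurable_Qf.
by apply: (cmeasurable_comp (cmeasurable_cpow _)); exact: measurable_Qsum.
Qed.

Let angular_dil s x : 0 < s -> D x -> angular (dil predT s x) = angular x.
Proof.
move=> s0 Dx; rewrite /angular Qsum_dil// cpowM ?q_gt0//.
have E j : cpow (Qf B j (dil predT s x)) (a j) = cpow s (a j) * cpow (Qf B j x) (a j).
  by rewrite -cpowM ?(Qf_gt0 pB j Dx)// (Qf_dil B predT x j s0).
have EP : \prod_j cpow (Qf B j (dil predT s x)) (a j) =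
    cpow s A * \prod_j cpow (Qf B j x) (a j).
  by rewrite /A cpow_sum -big_split/=; apply: eq_bigr => j _; exact: E.
apply: (etrans (congr1 (fun z => z * _) EP)).
rewrite (mulrACA (cpow s A) _ (cpow s (- A))).
by rewrite (mulrC (cpow s A) (cpow s (- A))) (cpowNr s A) mul1r.
Qed.

Let angularE x : angular x * cpow (q x) A = \prod_j cpow (Qf B j x) (a j).
Proof. by rewrite -mulrA cpowNr mulr1. Qed.

Let Re_N (z : R[i]) p : complex.Re (z + p%:R) = complex.Re z + p%:R.
Proof. by rewrite -(rmorph_nat (real_complex R)); case: z. Qed.

Let Re_sum (f : 'I_k -> R[i]) : complex.Re (\sum_j f j) = \sum_j complex.Re (f j).
Proof. exact: (raddf_sum (@complex.Re R)). Qed.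

Let S := \sum_j (a j + (n j)%:R).

Let SE : S = A + N%:R.
Proof. by rewrite /S big_split/= natr_sum. Qed.

Let S0 : 0 < complex.Re S.
Proof.
rewrite /S Re_sum (bigD1 (Ordinal hk))//= ltr_wpDr//.
by apply: sumr_ge0 => i _; exact/ltW.
Qed.

Let rA := complex.Re A.

(** The modulus of [angular]. Multiplied by [rg (q x)] it is the integrand [gamma_blocks] with the
    real exponents Re a_j. *)
Let rh (x : T) : R := expR (\sum_j complex.Re (a j) * ln (Qf B j x) - rA * ln (q x)).

Let rg (u : R) : R := expR (rA * ln u) * expR (- u).

Let rh_dil s x : 0 < s -> D x -> rh (dil predT s x) = rh x.
Proof.
move=> s0 Dx; rewrite /rh Qsum_dil// lnM ?posrE ?q_gt0//; congr expR.
have E j : complex.Re (a j) * ln (Qf B j (dil predT s x)) =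
    complex.Re (a j) * ln s + complex.Re (a j) * ln (Qf B j x).
  by rewrite -mulrDr -lnM ?posrE ?(Qf_gt0 pB j Dx)// (Qf_dil B predT x j s0).
have ES : \sum_j complex.Re (a j) * ln (Qf B j (dil predT s x)) =
    rA * ln s + \sum_j complex.Re (a j) * ln (Qf B j x).
  by rewrite /rA /A Re_sum mulr_suml -big_split/=; apply: eq_bigr => j _; exact: E.
apply: (etrans (congr1 (fun z => z - _) ES)).
rewrite (mulrDr rA (ln s)) opprD.
by rewrite (addrACA (rA * ln s)) subrr add0r.
Qed.

Let mrh : measurable_fun setT rh.
Proof.
apply: (measurableT_comp (@measurable_expR R)); apply: measurable_funB.
  apply: measurable_sum => j; apply: measurable_funM => //.
  by apply: (measurableT_comp (@measurable_ln R)); exact: measurable_Qf.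
apply: measurable_funM => //.
by apply: (measurableT_comp (@measurable_ln R)); exact: measurable_Qsum.
Qed.

Let mrg : measurable_fun setT rg.
Proof.
apply: measurable_funM; last exact: measurable_expRN.
apply: (measurableT_comp (@measurable_expR R)).
by apply: measurable_funM => //; exact: measurable_ln.
Qed.

Let norm_angular x : `|angular x| = (rh x)%:C.
Proof.
rewrite /angular normrM normr_prod normc_cpow.
under eq_bigr do rewrite normc_cpow.
rewrite -(rmorph_prod (real_complex R)) -(rmorphM (real_complex R)) -expR_sum -expRD.
by congr ((expR (_ + _))%:C); rewrite /rA; case: A => ? ? /=; rewrite mulNr.
Qed.

(** Some Re a_j may be negative here, so [rh] need not be bounded. The polar formula is read
    backwards: this integral times Gamma (Re S) > 0 equals Gamma (N) times the integral of
    [gamma_blocks] at real exponents, which is finite. *)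
Let rh_int : (\int[mu]_(x in D) (rh x * expR (- q x))%:E < +oo)%E.
Proof.
have b0 j : 0 < complex.Re ((complex.Re (a j))%:C + (n j)%:R : R[i]).
  by rewrite Re_N; have := a0 j; rewrite Re_N.
have [r [_ _ [ib _] _]] := gamma_blocks_integral hn pB b0.
have E x : rh x * rg (q x) =
    complex.Re (gamma_blocks B (fun j => (complex.Re (a j))%:C) x).
  rewrite /gamma_blocks.
  under eq_bigr do rewrite cpow_realr -(rmorphM (real_complex R)) -expRD.
  rewrite -(rmorph_prod (real_complex R))/= -expR_sum big_split/= sumrN.
  by rewrite /rh /rg -!expRD addrA subrK.
have := @polar_blocks _ _ _ hn B pB predT (Ordinal hk) isT rh rg mrh mrg
  (fun=> expR_ge0 _) (fun=> mulr_ge0 (expR_ge0 _) (expR_ge0 _)) rh_dil.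
set I := (\int[mu]_(x in D) (rh x * expR (- q x))%:E)%E.
have -> : (\int[leb]_(u in pos) (u ^+ N.-1 * rg u)%:E = (rgamma (complex.Re S))%:E)%E.
  rewrite -rgammaE//; apply: eq_integral => u /set_mem/posP u0.
  rewrite /rg mulrA; congr (_ * _)%:E; rewrite SE Re_N -[in RHS](prednK N0) -addn1 natrD.
  by rewrite addrA addrK mulrDl expRD mulr_natl -lnXn// lnK ?posrE ?exprn_gt0// mulrC.
move=> H; have g0 : 0 < rgamma (complex.Re S) by exact: rgamma_gt0.
have I0 : (0 <= I)%E.
  by apply: integral_ge0 => x _; rewrite lee_fin mulr_ge0 ?expR_ge0.
have : (I * (rgamma (complex.Re S))%:E < +oo)%E.
  have gN : 0 < rgamma (N%:R : R) by apply: (@rgamma_gt0 R); rewrite ltr0n.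
  rewrite -H; apply: (@lte_mul_pinfty R (rgamma (N%:R : R))%:E _ (ltW gN) isT).
  have /integrableP[_] := ib; apply: le_lt_trans; rewrite le_eqVlt; apply/orP; left.
  apply/eqP; apply: eq_integral => x _.
  have rg0 : 0 <= rh x * rg (q x).
    exact: mulr_ge0 (expR_ge0 _) (mulr_ge0 (expR_ge0 _) (expR_ge0 _)).
  exact: (etrans (congr1 EFin (esym (ger0_norm rg0))) (congr1 (fun z => `|z|%:E) (E x))).
by case: I {H} I0 => [I|//|//] _; rewrite ?ltry// gt0_mulye ?lte_fin.
Qed.

Let ceN_angular : cmeasurable (fun x => (expR (- q x))%:C * angular x).
Proof.
apply: cmeasurableM => //; apply: cmeasurable_real; apply: measurable_expRN.
exact: measurable_Qsum.
Qed.

Let cintegrable_angular : cintegrable mu D (fun x => (expR (- q x))%:C * angular x).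
Proof.
apply: (@cintegrable_le _ _ _ _ _ _ (fun x => rh x * expR (- q x)) mD ceN_angular).
  apply/integrableP; split.
    apply/measurable_EFinP/measurable_funTS/measurable_funM => //.
    by apply: measurable_expRN; exact: measurable_Qsum.
  apply: le_lt_trans rh_int; rewrite le_eqVlt; apply/orP; left.
  apply/eqP; apply: eq_integral => x _.
  have p0 : 0 <= rh x * expR (- q x) by rewrite mulr_ge0 ?expR_ge0.
  exact: (congr1 EFin (ger0_norm p0)).
move=> x _; apply: Re_Im_le_normc.
rewrite normrM (norm_angular x) normc_def /= expr0n addr0 sqrtr_sqr ger0_norm ?expR_ge0//.
by rewrite -(rmorphM (real_complex R)) mulrC.
Qed.

Lemma polar_cpow (G : R -> R[i]) : cmeasurable G ->
  cintegrable leb pos (fun u => cpow u (S - 1) * G u) ->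
  cintegrable mu D (fun x => (\prod_j cpow (Qf B j x) (a j)) * G (q x)) /\
  cGamma S * cintegral mu D (fun x => (\prod_j cpow (Qf B j x) (a j)) * G (q x)) =
  cintegral mu D (gamma_blocks B a) * cintegral leb pos (fun u => cpow u (S - 1) * G u).
Proof.
have main (H : R -> R[i]) : cmeasurable H ->
    cintegrable leb pos (fun u => cpow u (S - 1) * H u) ->
    cintegrable mu D (fun x => (\prod_j cpow (Qf B j x) (a j)) * H (q x)) /\
    (rgamma (N%:R : R))%:C *
      cintegral mu D (fun x => (\prod_j cpow (Qf B j x) (a j)) * H (q x)) =
    cintegral mu D (fun x => (expR (- q x))%:C * angular x) *
      cintegral leb pos (fun u => cpow u (S - 1) * H u).
  move=> mH iH; pose H' u := cpow u A * H u.
  have mH' : cmeasurable H' by apply: cmeasurableM => //; exact: cmeasurable_cpow.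
  have HE : {in pos, (fun u => cpow u (S - 1) * H u) =1 (fun u => (u ^+ N.-1)%:C * H' u)}.
    move=> u /set_mem/posP u0; rewrite /H' -(cpow_natr N.-1 u0) mulrA -cpowD.
    by rewrite SE -[in LHS](prednK N0) -addn1 natrD addrA addrK addrC.
  have FE x : angular x * H' (q x) = (\prod_j cpow (Qf B j x) (a j)) * H (q x).
    by rewrite /H' mulrA angularE.
  have iH' : cintegrable leb pos (fun u => (u ^+ N.-1)%:C * H' u).
    exact: (eq_cintegrable mpos HE iH).
  have [I1 E1] := @polar_cintegral_blocks _ _ _ hn B pB predT (Ordinal hk) isT angular H'
    cmeasurable_angular mH' angular_dil cintegrable_angular iH'.
  have L : {in D, (fun x => angular x * H' (q x)) =1
      (fun x => (\prod_j cpow (Qf B j x) (a j)) * H (q x))} by move=> x _; exact: FE.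
  split; first exact: (eq_cintegrable mD L I1).
  by rewrite -(eq_cintegral mu L) (eq_cintegral leb HE).
move=> mG iG; have [I1 E1] := main G mG iG; split => //.
pose g u := (expR (- u))%:C : R[i].
have mg : cmeasurable g by apply: cmeasurable_real; exact: measurable_expRN.
have [I2 E2] := main g mg (cintegrable_gamma S0).
have gE : {in D, (fun x => (\prod_j cpow (Qf B j x) (a j)) * g (q x)) =1 gamma_blocks B a}.
  move=> x _; rewrite /gamma_blocks [RHS]big_split/=; congr (_ * _).
  by rewrite -(rmorph_prod (real_complex R)) -expR_sum sumrN.
have r0 : ((rgamma (N%:R : R))%:C : R[i]) != 0.
  by rewrite fmorph_eq0 gt_eqF// (@rgamma_gt0 R)// ltr0n.
rewrite (eq_cintegral mu gE) -[X in _ = _ * X]cGammaE in E2.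
(* With A0 the angular integral, the two instances read Gamma (N) I = A0 J and Gamma (N) M = A0
   Gamma (S). Multiplying the goal by Gamma (N) combines them without dividing by A0. *)
apply: (mulfI r0); rewrite mulrCA E1 mulrA [X in X * _]mulrC -E2; ring.
Qed.

End homogeneous.

Section dirichlet.
Context {R : realType} {k : nat} {n : 'I_k -> nat}.
Hypothesis hk : (0 < k)%N.
Hypothesis hn : forall j, (0 < n j)%N.
Variable B : forall j : 'I_k, 'M[R[i]]_(n j).
Hypothesis pB : forall j, posdefmx (B j).
Variables (alpha : 'I_k.+1 -> R[i]) (h : R[i]).
Hypothesis alpha0 : forall j, 0 < complex.Re (alpha j).
Local Notation N := (\sum_j n j)%N.
Local Notation T := (N.-tuple (planeC R)).
Local Notation mu := (@lebesgueC R N).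
Local Notation D := (@nonzero_blocks R k n).
Local Notation leb := (@lebesgue_measure R).
Local Notation pos := (`]0%R, +oo[%classic : set R).
Local Notation q := (Qsum B predT).

Let a (j : 'I_k) := alpha (inI j).
Let al := alpha ord_max.
Let S := \sum_j (a j + (n j)%:R).

Hypothesis alh0 : 0 < complex.Re (al - h).
Hypothesis Sh0 : 0 < complex.Re (S + h).

Let Re_nat p : complex.Re (p%:R : R[i]) = p%:R.
Proof. by rewrite -(rmorph_nat (real_complex R)). Qed.

Let a0 j : 0 < complex.Re (a j + (n j)%:R).
Proof. by rewrite raddfD/= Re_nat ltr_wpDr ?ler0n// alpha0. Qed.

Let S0 : 0 < complex.Re S.
Proof.
rewrite /S (raddf_sum (@complex.Re R)) (bigD1 (Ordinal hk))//= ltr_wpDr//.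
by apply: sumr_ge0 => i _; exact/ltW.
Qed.

Let EE : dirichlet2_exponent (n := n) alpha = S + al.
Proof. by rewrite /dirichlet2_exponent big_ord_recr/= addrAC /S big_split. Qed.

Let G (u : R) := cpow u h * cpow (1 + u) (- (S + al)).

Let integrandE (x : T) :
  phi9 B h (blocks_of_tuple x) * dirichlet2_density B alpha (blocks_of_tuple x) =
  dirichlet2_const B alpha * ((\prod_j cpow (Qf B j x) (a j)) * G (q x)).
Proof.
rewrite /phi9 /dirichlet2_density EE /G.
have -> : \sum_j qform (B j) (blocks_of_tuple x j) = q x by [].
rewrite (_ : \prod_j cpow (qform (B j) (blocks_of_tuple x j)) (alpha (inI j)) =
  \prod_j cpow (Qf B j x) (a j))//.
set P := \prod_j _; set c := dirichlet2_const _ _.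
set u := cpow _ h; set v := cpow _ _; ring.
Qed.

(** The block factors of the normalising constant are the reciprocal of the integral of the product
    of Q_j^alpha_j e^(-Q_j): Gamma values, powers of pi and determinants cancel blockwise. *)
Let const_moment (r : R) : 0 < r -> \prod_j \det (B j) = r%:C ->
  \prod_j (\det (B j) * (cGamma (n j)%:R / ((pi ^+ n j)%:C * cGamma (a j + (n j)%:R)))) *
  ((pi ^+ N / r)%:C * \prod_j (cGamma (a j + (n j)%:R) / cGamma (n j)%:R)) = 1.
Proof.
move=> r0 rE.
have pi0 p : ((pi ^+ p : R)%:C : R[i]) != 0.
  by rewrite fmorph_eq0 expf_neq0// gt_eqF// pi_gt0.
have E j : \det (B j) * (cGamma (n j)%:R / ((pi ^+ n j)%:C * cGamma (a j + (n j)%:R))) *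
    (cGamma (a j + (n j)%:R) / cGamma (n j)%:R) = \det (B j) * ((pi ^+ n j)%:C)^-1.
  have g1 : cGamma (n j)%:R != 0 :> R[i] by apply: cGamma_neq0; rewrite Re_nat ltr0n.
  have := cGamma_neq0 (a0 j); have := pi0 (n j); move: g1.
  set x := cGamma _; set y := cGamma _; move: ((pi ^+ n j)%:C : R[i]) => p x0 p0 y0.
  by field; rewrite x0 p0 y0.
rewrite mulrCA -big_split/= (eq_bigr _ (fun j _ => E j)) big_split/= rE prodfV.
rewrite -(rmorph_prod (real_complex R)) prodrXr.
rewrite -(fmorphV (real_complex R)) -!(rmorphM (real_complex R)) -(rmorph1 (real_complex R)).
congr (real_complex R _).
have : (pi ^+ N : R) != 0 by rewrite expf_neq0// gt_eqF// pi_gt0.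
by move: (pi ^+ N : R) => p p0; field; rewrite p0 gt_eqF.
Qed.

Lemma dirichlet2_average_phi9 :
  dirichlet2_integrable B alpha (phi9 B h) /\
  dirichlet2_average B alpha (phi9 B h) =
    cGamma (S + h) / cGamma S * (cGamma (al - h) / cGamma al).
Proof.
have mD : measurable (D : set T) by exact: measurable_nonzero_blocks.
have mpos : measurable (pos : set (measurableTypeR R)) by [].
have mG : cmeasurable G.
  apply: cmeasurableM; first exact: cmeasurable_cpow.
  by apply: (cmeasurable_comp (cmeasurable_cpow _)); exact: measurable_funD.
(* The Beta integral is taken at S + h and al - h: the shift cancels in the sum, so the exponent of
   1 + u is the one in the density. *)
have ShE : S + h + (al - h) = S + al by rewrite addrACA subrr addr0.
have [ib Eb] := cGammaM Sh0 alh0.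
have bE : {in pos, (fun u => cpow u (S + h - 1) * cpow (1 + u) (- (S + h + (al - h)))) =1
    (fun u => cpow u (S - 1) * G u)}.
  by move=> u _; rewrite ShE /G mulrA -cpowD addrAC.
have iG : cintegrable leb pos (fun u => cpow u (S - 1) * G u).
  exact: (eq_cintegrable mpos bE ib).
have [I1 E1] := polar_cpow hk hn pB a0 mG iG.
have [r [r0 rE _ ME]] := gamma_blocks_integral hn pB a0.
have iE : {in D, (fun x => dirichlet2_const B alpha *
      ((\prod_j cpow (Qf B j x) (a j)) * G (q x))) =1
    (fun x => phi9 B h (blocks_of_tuple x) *
      dirichlet2_density B alpha (blocks_of_tuple x))}.
  by move=> x _; rewrite integrandE.
split; first exact: (eq_cintegrable mD iE (cintegrableZ _ mD I1)).
rewrite /dirichlet2_average -(eq_cintegral mu iE) cintegralZ//.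
have gS := cGamma_neq0 S0; have gA : cGamma al != 0 by apply: cGamma_neq0; exact: alpha0.
rewrite (eq_cintegral leb bE) ShE in Eb.
rewrite ME in E1.
have K := const_moment r0 rE.
rewrite /dirichlet2_const EE.
move: Eb E1 K gS gA; rewrite -/al -/S.
set I := cintegral mu D _; set J := cintegral leb pos _; set M := (_ / r)%:C * _.
set C := \prod_j _; set x := cGamma (S + h); set y := cGamma (al - h).
set z := cGamma (S + al); set w := cGamma S; set t := cGamma al.
move: I J M C x y z w t => I J M C x y z w t Eb E1 K gS gA.
(* What remains is algebra from x y = z J (Beta), w I = M J (polar) and C M = 1 (normalisation),
   after clearing the nonzero denominators w = Gamma (S) and t = Gamma (al). *)
apply: (mulfI gS); apply: (mulfI gA).
transitivity (x * y); last by field; rewrite gS gA.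
transitivity (C * z * (w * I)); first by field.
by rewrite E1 Eb mulrACA K mul1r.
Qed.

End dirichlet.

Theorem mainTheorem11 (R : realType) (k : nat) (hk : (0 < k)%N)
    (n : 'I_k -> nat) (hn : forall j, (0 < n j)%N)
    (B : forall j : 'I_k, 'M[R[i]]_(n j)) (hB : forall j, posdefmx (B j))
    (alpha : 'I_k.+1 -> R[i]) (h : R[i])
    (halpha : forall j : 'I_k.+1, 0 < complex.Re (alpha j))
    (hlast : 0 < complex.Re (alpha ord_max - h))
    (hsum : 0 < complex.Re (\sum_(j < k) (alpha (inI j) + (n j)%:R) + h)) :
  dirichlet2_integrable B alpha (phi9 B h) /\
  dirichlet2_average B alpha (phi9 B h) =
    cGamma (\sum_(j < k) (alpha (inI j) + (n j)%:R) + h) /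
      cGamma (\sum_(j < k) (alpha (inI j) + (n j)%:R)) *
    (cGamma (alpha ord_max - h) / cGamma (alpha ord_max)).
Proof. exact: dirichlet2_average_phi9. Qed.
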